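(* A typical $T\in(\mathcal{P}_1(\ell_2),\mathrm{SOT})$ has a non-trivial invariant subspace, and likewise a typical $T\in(\mathcal{P}_1(\ell_2),\mathrm{SOT}^* )$ has a non-trivial invariant subspace.
   Context: $X=\ell_2=\ell_2(\mathbb{Z}_+)$ (complex) is equipped with its canonical basis. A vector is positive if all its coordinates are $\ge0$; a bounded operator $T$ on $X$ is positive if it maps positive vectors to positive vectors. $\mathcal{P}_1(X)$ is the set of bounded positive operators (in this sense) with $\|T\|\le1$. A non-trivial invariant subspace of $T$ is a closed subspace $Y$ of $X$ with $Y\ne\{0\}$, $Y\ne X$ and $T(Y)\subseteq Y$. $\mathrm{SOT}$: $T_i\to T$ iff $\|T_ix-Tx\|\to0$ for every $x\in X$. $\mathrm{SOT}^*$: $T_i\to T$ iff $\|T_ix-Tx\|\to0$ for every $x\in X$ and $\|T_i^*x^*-T^*x^*\|\to0$ for every $x^*\in X^*$. ''A typical $T\in(\mathcal{P}_1(X),\tau)$ has property (P)'' means that the set of $T\in\mathcal{P}_1(X)$ with (P) is comeager, i.e. contains a dense $G_\delta$ subset of $(\mathcal{P}_1(X),\tau)$. *)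

(* Defs.v *)
From HB Require Import structures.
From mathcomp Require Import all_boot all_order all_algebra.
From mathcomp Require Import complex ring.
From mathcomp Require Import all_classical all_reals all_analysis borel_hierarchy.

Set Implicit Arguments.
Unset Strict Implicit.
Unset Printing Implicit Defensive.
Import Order.TTheory GRing.Theory Num.Theory.
Import numFieldNormedType.Exports.
Local Open Scope classical_set_scope.
Local Open Scope complex_scope.
Local Open Scope ring_scope.

(** Over [R[i]] the norm [`|x|] lives in [R[i]]; [rnorm x] is the same number
    read in [R] (see [rnormE]). *)
Definition rnorm {R : realType} {V : normedZmodType R[i]} (x : V) : R :=
  complex.Re `|x|.

Section RNorm.
Context {R : realType}.
Implicit Types V W : normedModType R[i].

Lemma rnormE (V : normedZmodType R[i]) (x : V) : (rnorm x)%:C = `|x|.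
Proof. by apply: RRe_real; exact: normr_real. Qed.

Lemma rnorm_ge0 (V : normedZmodType R[i]) (x : V) : 0 <= rnorm x.
Proof. by rewrite -ler0c rnormE. Qed.

Lemma rnorm0 (V : normedZmodType R[i]) : rnorm (0 : V) = 0.
Proof. by rewrite /rnorm normr0. Qed.

Lemma rnorm0_eq0 (V : normedZmodType R[i]) (x : V) : rnorm x = 0 -> x = 0.
Proof. by move=> x0; apply/normr0_eq0; rewrite -rnormE x0. Qed.

Lemma ler_rnormD (V : normedZmodType R[i]) (x y : V) :
  rnorm (x + y) <= rnorm x + rnorm y.
Proof. by rewrite -lecR rmorphD /= !rnormE ler_normD. Qed.

Lemma rnormZ V (a : R[i]) (x : V) : rnorm (a *: x) = rnorm a * rnorm x.
Proof. by apply: complexI; rewrite rmorphM /= !rnormE normrZ. Qed.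

Lemma rnormM (a b : R[i]) : rnorm (a * b) = rnorm a * rnorm b.
Proof. by apply: complexI; rewrite rmorphM /= !rnormE normrM. Qed.

Lemma rnormV (a : R[i]) : rnorm a^-1 = (rnorm a)^-1.
Proof. by apply: complexI; rewrite fmorphV /= !rnormE normfV. Qed.

Lemma rnorm_real (a : R) : rnorm (a%:C) = `|a|.
Proof. by rewrite /rnorm normc_def /= expr0n /= addr0 sqrtr_sqr. Qed.

End RNorm.

Section Ell2.
Variable R : realType.
Implicit Types x y : nat -> R[i].

Definition sqnorm_partial x : nat -> R := series (fun n => rnorm (x n) ^+ 2).

Definition square_summable : {pred (nat -> R[i])} :=
  [pred x | `[< cvgn (sqnorm_partial x) >]].

Definition seq_norm2 x : R := Num.sqrt (limn (sqnorm_partial x)).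

Lemma sqnorm_partial_nd x : nondecreasing_seq (sqnorm_partial x).
Proof.
by apply/nondecreasing_seqP => n; rewrite /sqnorm_partial seriesSr lerDl sqr_ge0.
Qed.

Lemma sqnorm_partial_ge0 x n : 0 <= sqnorm_partial x n.
Proof. by apply: sumr_ge0 => i _; exact: sqr_ge0. Qed.

Lemma sqnorm_partial_le x : x \in square_summable ->
  forall n, Num.sqrt (sqnorm_partial x n) <= seq_norm2 x.
Proof.
move=> /asboolP cx n; apply: ler_wsqrtr.
by apply: nondecreasing_cvgn_le => //; exact: sqnorm_partial_nd.
Qed.

Lemma square_summable_bound x (M : R) :
  (forall n, Num.sqrt (sqnorm_partial x n) <= M) ->
  x \in square_summable /\ seq_norm2 x <= M.
Proof.
move=> xM.
have M0 : 0 <= M by apply: le_trans (xM 0%N); exact: sqrtr_ge0.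
have xM2 n : sqnorm_partial x n <= M ^+ 2.
  by rewrite -[leLHS]sqr_sqrtr ?sqnorm_partial_ge0 // ler_pXn2r ?nnegrE ?sqrtr_ge0.
have cx : cvgn (sqnorm_partial x).
  apply: nondecreasing_is_cvgn; first exact: sqnorm_partial_nd.
  by exists (M ^+ 2) => _ [n _ <-]; exact: xM2.
split; first exact/asboolP.
rewrite -(ger0_norm M0) -sqrtr_sqr; apply: ler_wsqrtr.
by apply: limr_le => //; apply: nearW.
Qed.

Lemma sqrt_sum_sqrD (A B a b : R) : 0 <= A -> 0 <= B -> 0 <= a -> 0 <= b ->
  Num.sqrt ((A + B) ^+ 2 + (a + b) ^+ 2) <=
  Num.sqrt (A ^+ 2 + a ^+ 2) + Num.sqrt (B ^+ 2 + b ^+ 2).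
Proof.
move=> A0 B0 a0 b0.
set s := Num.sqrt (A ^+ 2 + a ^+ 2); set t := Num.sqrt (B ^+ 2 + b ^+ 2).
have s0 : 0 <= s by exact: sqrtr_ge0.
have t0 : 0 <= t by exact: sqrtr_ge0.
have s2 : s ^+ 2 = A ^+ 2 + a ^+ 2 by rewrite sqr_sqrtr // addr_ge0 ?sqr_ge0.
have t2 : t ^+ 2 = B ^+ 2 + b ^+ 2 by rewrite sqr_sqrtr // addr_ge0 ?sqr_ge0.
rewrite -[leRHS]ger0_norm ?addr_ge0 // -sqrtr_sqr; apply: ler_wsqrtr.
have st : A * B + a * b <= s * t.
  rewrite -(@ler_pXn2r _ 2) // ?nnegrE ?addr_ge0 ?mulr_ge0 //.
  rewrite exprMn s2 t2 -subr_ge0.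
  have -> : (A ^+ 2 + a ^+ 2) * (B ^+ 2 + b ^+ 2) - (A * B + a * b) ^+ 2 =
    (A * b - a * B) ^+ 2 by ring.
  exact: sqr_ge0.
rewrite [leRHS]sqrrD s2 t2 -subr_ge0.
have -> : A ^+ 2 + a ^+ 2 + s * t *+ 2 + (B ^+ 2 + b ^+ 2) -
  ((A + B) ^+ 2 + (a + b) ^+ 2) = (s * t - (A * B + a * b)) *+ 2 by ring.
by rewrite mulrn_wge0 // subr_ge0.
Qed.

Lemma sqnorm_partialD x y n : Num.sqrt (sqnorm_partial (x + y) n) <=
  Num.sqrt (sqnorm_partial x n) + Num.sqrt (sqnorm_partial y n).
Proof.
elim: n => [|n IHn].
  by rewrite /sqnorm_partial /series /= !big_geq // sqrtr0 addr0.
have E z : sqnorm_partial z n.+1 =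
    Num.sqrt (sqnorm_partial z n) ^+ 2 + rnorm (z n) ^+ 2.
  by rewrite sqr_sqrtr ?sqnorm_partial_ge0 // /sqnorm_partial seriesSr.
rewrite !E; apply: le_trans; last first.
  by apply: sqrt_sum_sqrD; rewrite ?sqrtr_ge0 ?rnorm_ge0.
apply: ler_wsqrtr; apply: lerD; rewrite ler_pXn2r ?nnegrE ?addr_ge0
  ?sqrtr_ge0 ?rnorm_ge0 //.
exact: ler_rnormD.
Qed.

Lemma sqnorm_partialZ (a : R[i]) x n : Num.sqrt (sqnorm_partial (a *: x) n) =
  rnorm a * Num.sqrt (sqnorm_partial x n).
Proof.
rewrite -[rnorm a]ger0_norm ?rnorm_ge0 // -sqrtr_sqr -sqrtrM ?sqr_ge0 //.
congr Num.sqrt; rewrite /sqnorm_partial /series /= mulr_sumr.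
by apply: eq_bigr => i _; rewrite -exprMn -rnormM.
Qed.

Lemma square_summableD x y : x \in square_summable -> y \in square_summable ->
  (x + y \in square_summable) /\ seq_norm2 (x + y) <= seq_norm2 x + seq_norm2 y.
Proof.
move=> xs ys; apply: square_summable_bound => n.
apply: le_trans (sqnorm_partialD x y n) _.
by apply: lerD; exact: sqnorm_partial_le.
Qed.

Lemma square_summableZ (a : R[i]) x : x \in square_summable ->
  (a *: x \in square_summable) /\ seq_norm2 (a *: x) <= rnorm a * seq_norm2 x.
Proof.
move=> xs; apply: square_summable_bound => n; rewrite sqnorm_partialZ.
by rewrite ler_wpM2l ?rnorm_ge0 // sqnorm_partial_le.
Qed.

Fact square_summable_submod : submod_closed square_summable.
Proof.
split=> [|a x y xs ys].
  apply: (proj1 (@square_summable_bound 0 0 _)) => n.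
  rewrite /sqnorm_partial /series /= big1 ?sqrtr0 // => i _.
  by rewrite [(0 : nat -> R[i]) i]/(0 : R[i]) rnorm0 expr0n.
exact: proj1 (square_summableD (proj1 (square_summableZ a xs)) ys).
Qed.

HB.instance Definition _ :=
  GRing.isSubmodClosed.Build R[i] (nat -> R[i]) square_summable
    square_summable_submod.

(** Complex [ell_2] indexed by [0, 1, 2, ...]. *)
Record ell2 := Ell2 {
  coord :> nat -> R[i];
  coordP : coord \in square_summable }.

HB.instance Definition _ := [isSub for coord].
HB.instance Definition _ := [Choice of ell2 by <:].
HB.instance Definition _ := [SubChoice_isSubLmodule of ell2 by <:].

Definition ell2_norm (x : ell2) : R[i] := (seq_norm2 x)%:C.

Lemma ell2_normD (x y : ell2) : ell2_norm (x + y) <= ell2_norm x + ell2_norm y.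
Proof.
rewrite /ell2_norm -rmorphD /= lecR.
by have [] := square_summableD (coordP x) (coordP y).
Qed.

Lemma ell2_norm0 (x : ell2) : ell2_norm x = 0 -> x = 0.
Proof.
move=> /complexI x0; apply/val_inj/funext => n /=.
have : Num.sqrt (sqnorm_partial x n.+1) <= 0.
  by rewrite -x0 sqnorm_partial_le // coordP.
rewrite -sqrtr0 ler_sqrt // => s0.
have : rnorm (x n) ^+ 2 <= 0.
  by apply: le_trans s0; rewrite /sqnorm_partial seriesSr lerDr sqnorm_partial_ge0.
rewrite exprn_even_le0 //= => /eqP; exact: rnorm0_eq0.
Qed.

Lemma ell2_normZ (a : R[i]) (x : ell2) : ell2_norm (a *: x) = `|a| * ell2_norm x.
Proof.
rewrite /ell2_norm -rnormE -rmorphM /=; congr (_%:C); apply/eqP.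
have le := proj2 (square_summableZ a (coordP x)).
rewrite eq_le le /=.
have [->|a0] := eqVneq a 0; first by rewrite rnorm0 mul0r sqrtr_ge0.
have ra0 : 0 < rnorm a.
  rewrite lt_neqAle rnorm_ge0 andbT eq_sym; apply/eqP => /rnorm0_eq0 /eqP.
  by rewrite (negPf a0).
have := proj2 (square_summableZ a^-1 (coordP (a *: x))).
rewrite [coord (a *: x)]/(a *: coord x) scalerA mulVf // scale1r => h.
rewrite -ler_pdivlMl //; by rewrite -rnormV.
Qed.

HB.instance Definition _ :=
  Lmodule_isNormed.Build R[i] ell2 ell2_normD ell2_normZ ell2_norm0.

End Ell2.

Section BoundedOperators.
Context {R : realType}.
Variables V W : normedModType R[i].

Definition bounded_linear : {pred (V -> W)} :=
  [pred f | `[< linear f /\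
                exists M : R, forall x, rnorm (f x) <= M * rnorm x >]].

Definition opnorm (f : V -> W) : R :=
  sup [set rnorm (f x) | x in [set x | rnorm x <= 1]].

Lemma bounded_linear_linear (f : V -> W) : f \in bounded_linear -> linear f.
Proof. by move=> /asboolP[]. Qed.

Lemma bounded_linear0 (f : V -> W) : f \in bounded_linear -> f 0 = 0.
Proof.
move=> /bounded_linear_linear /(_ (-1) 0 0).
by rewrite scaler0 addr0 scaleN1r addNr.
Qed.

Lemma bounded_linearZ (f : V -> W) : f \in bounded_linear ->
  forall a x, f (a *: x) = a *: f x.
Proof.
move=> fb a x; have := bounded_linear_linear fb a x 0.
by rewrite (bounded_linear0 fb) !addr0.
Qed.

Lemma opnorm_has_sup (f : V -> W) : f \in bounded_linear ->
  has_sup [set rnorm (f x) | x in [set x | rnorm x <= 1]].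
Proof.
move=> /asboolP[_ [M fM]]; split.
  by exists (rnorm (f 0)), 0 => //=; rewrite rnorm0.
exists `|M| => _ [x /= x1 <-]; apply: le_trans (fM x) _.
apply: le_trans (ler_wpM2r (rnorm_ge0 x) (ler_norm M)) _.
by rewrite -[leRHS]mulr1 ler_wpM2l.
Qed.

Lemma opnorm_ge0 (f : V -> W) : f \in bounded_linear -> 0 <= opnorm f.
Proof.
move=> fb; apply: le_trans (rnorm_ge0 (f 0)) _.
apply: ub_le_sup; first exact: (opnorm_has_sup fb).2.
by exists 0 => //=; rewrite rnorm0.
Qed.

Lemma le_opnorm (f : V -> W) : f \in bounded_linear ->
  forall x, rnorm (f x) <= opnorm f * rnorm x.
Proof.
move=> fb x; have [x0|x0] := eqVneq (rnorm x) 0.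
  by rewrite (rnorm0_eq0 x0) (bounded_linear0 fb) !rnorm0 mulr0.
have x_gt0 : 0 < rnorm x by rewrite lt_neqAle eq_sym x0 rnorm_ge0.
have sc (U : normedModType R[i]) (u : U) :
    rnorm ((rnorm x)^-1%:C *: u) = (rnorm x)^-1 * rnorm u.
  by rewrite rnormZ rnorm_real ger0_norm // invr_ge0 ltW.
rewrite -ler_pdivrMr // mulrC -sc -(bounded_linearZ fb).
apply: ub_le_sup; first exact: (opnorm_has_sup fb).2.
by exists ((rnorm x)^-1%:C *: x) => //=; rewrite sc mulVf.
Qed.

Lemma opnorm_le (f : V -> W) (M : R) : linear f -> 0 <= M ->
  (forall x, rnorm (f x) <= M * rnorm x) ->
  f \in bounded_linear /\ opnorm f <= M.
Proof.
move=> fl M0 fM; have fb : f \in bounded_linear by apply/asboolP; split; [|exists M].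
split=> //; apply: ge_sup; first exact: (opnorm_has_sup fb).1.
move=> _ [x /= x1 <-]; apply: le_trans (fM x) _.
by rewrite -[leRHS]mulr1 ler_wpM2l.
Qed.

Lemma opnormD (f g : V -> W) :
  f \in bounded_linear -> g \in bounded_linear ->
  f + g \in bounded_linear /\ opnorm (f + g) <= opnorm f + opnorm g.
Proof.
move=> fb gb; apply: opnorm_le; last 2 first.
- by rewrite addr_ge0 ?opnorm_ge0.
- move=> x; apply: le_trans (ler_rnormD _ _) _.
  by rewrite mulrDl lerD // le_opnorm.
move=> a x y; rewrite ![(f + g) _]/(f _ + g _).
by rewrite (bounded_linear_linear fb) (bounded_linear_linear gb) scalerDr addrACA.
Qed.

Lemma opnormZ_le (a : R[i]) (f : V -> W) : f \in bounded_linear ->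
  a *: f \in bounded_linear /\ opnorm (a *: f) <= rnorm a * opnorm f.
Proof.
move=> fb; apply: opnorm_le; last 2 first.
- by rewrite mulr_ge0 ?rnorm_ge0 ?opnorm_ge0.
- move=> x; rewrite [(a *: f) x]/(a *: f x) rnormZ -mulrA.
  by rewrite ler_wpM2l ?rnorm_ge0 ?le_opnorm.
move=> b x y; rewrite -[LHS]/(a *: f (b *: x + y)).
rewrite -[RHS]/(b *: (a *: f x) + a *: f y).
rewrite (bounded_linear_linear fb).
by rewrite scalerDr !scalerA mulrC.
Qed.

Fact bounded_linear_submod : submod_closed bounded_linear.
Proof.
split=> [|a f g fb gb].
  apply: (proj1 (@opnorm_le 0 0 _ (lexx _) _)) => [a x y|x].
    by rewrite ![(0 : V -> W) _]/(0 : W) scaler0 addr0.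
  by rewrite [(0 : V -> W) _]/(0 : W) rnorm0 mul0r.
exact: (opnormD (opnormZ_le a fb).1 gb).1.
Qed.

HB.instance Definition _ :=
  GRing.isSubmodClosed.Build R[i] (V -> W) bounded_linear bounded_linear_submod.

(** The space [B(V, W)] of bounded linear maps with the operator norm. *)
Record bop := Bop {
  bop_fun :> V -> W;
  bopP : bop_fun \in bounded_linear }.

HB.instance Definition _ := [isSub for bop_fun].
HB.instance Definition _ := [Choice of bop by <:].
HB.instance Definition _ := [SubChoice_isSubLmodule of bop by <:].

HB.instance Definition _ (f : bop) :=
  GRing.isLinear.Build R[i] V W *:%R (bop_fun f) (bounded_linear_linear (bopP f)).

Definition bop_norm (f : bop) : R[i] := (opnorm f)%:C.

Lemma bop_normD (f g : bop) : bop_norm (f + g) <= bop_norm f + bop_norm g.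
Proof.
rewrite /bop_norm -rmorphD /= lecR.
by have [] := opnormD (bopP f) (bopP g).
Qed.

Lemma bop_norm0 (f : bop) : bop_norm f = 0 -> f = 0.
Proof.
move=> /complexI f0; apply/val_inj/funext => x /=; apply: rnorm0_eq0.
apply/eqP; rewrite eq_le rnorm_ge0 andbT.
by have := le_opnorm (bopP f) x; rewrite f0 mul0r.
Qed.

Lemma bop_normZ (a : R[i]) (f : bop) : bop_norm (a *: f) = `|a| * bop_norm f.
Proof.
rewrite /bop_norm -rnormE -rmorphM /=; congr (_%:C); apply/eqP.
rewrite eq_le (opnormZ_le a (bopP f)).2 /=.
have [->|a0] := eqVneq a 0; first by
  rewrite rnorm0 mul0r; exact: (opnorm_ge0 (bopP (0 *: f))).
have ra0 : 0 < rnorm a.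
  rewrite lt_neqAle rnorm_ge0 andbT eq_sym; apply/eqP => /rnorm0_eq0 /eqP.
  by rewrite (negPf a0).
rewrite -ler_pdivlMl // -rnormV.
have := (opnormZ_le a^-1 (bopP (a *: f))).2.
by rewrite [bop_fun (a *: f)]/(a *: bop_fun f) scalerA mulVf // scale1r.
Qed.

HB.instance Definition _ :=
  Lmodule_isNormed.Build R[i] bop bop_normD bop_normZ bop_norm0.

End BoundedOperators.

Lemma bop_comp_subproof {R : realType} (U V W : normedModType R[i])
  (g : bop V W) (f : bop U V) : (g : V -> W) \o f \in @bounded_linear R U W.
Proof.
apply: (proj1 (@opnorm_le _ _ _ _ (opnorm g * opnorm f) _ _ _)).
- by move=> a x y; rewrite /= !linearP.
- by rewrite mulr_ge0 ?(opnorm_ge0 (bopP _)).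
move=> x; apply: le_trans (le_opnorm (bopP g) _) _.
by rewrite -mulrA ler_wpM2l ?(opnorm_ge0 (bopP _)) ?(le_opnorm (bopP _)).
Qed.

Definition bop_comp {R : realType} (U V W : normedModType R[i])
  (g : bop V W) (f : bop U V) : bop U W := Bop (bop_comp_subproof g f).

Lemma initial_cvgE (S : choiceType) (T : topologicalType) (f : S -> T)
  (F : set_system S) (s : S) : Filter F ->
  (F --> (s : initial_topology f)) <-> (f @ F --> f s).
Proof.
move=> FF; split => [Fs A /(@initial_continuous _ _ f s) /Fs//|Ffs A].
case=> _ [[B oB <-] Bs BA]; apply: filterS BA _.
by apply: Ffs; apply: open_nbhs_nbhs.
Qed.

Lemma pair_cvgE (I : Type) (F : set_system I) (X Y : topologicalType)
  (f : I -> X) (g : I -> Y) (x : X) (y : Y) : Filter F ->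
  ((f i, g i) @[i --> F] --> (x, y)) <-> (f @ F --> x /\ g @ F --> y).
Proof.
move=> FF; split=> [h|[fx gy]]; last exact: (cvg_pair fx gy).
by split; [exact: (cvg_comp _ _ h cvg_fst)|exact: (cvg_comp _ _ h cvg_snd)].
Qed.

Lemma ptws_cvgE (U : Type) (X : topologicalType) (I : Type)
  (F : set_system I) (f : I -> U -> X) (g : U -> X) : Filter F ->
  ((f : I -> {ptws U -> X}) @ F --> (g : {ptws U -> X})) <->
  forall u, f i u @[i --> F] --> g u.
Proof.
move=> FF; split=> [/cvg_sup h u|h].
  by have /initial_cvgE := h u; apply.
apply/cvg_sup => u; apply/initial_cvgE; exact: h.
Qed.

Section OperatorTopologies.
Context {R : realType}.
Variables V W : normedModType R[i].

(** The topological dual, with the dual norm. *)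
Definition dual (U : normedModType R[i]) := bop U R[i]^o.
HB.instance Definition _ U := NormedModule.on (dual U).

(** The Banach-space adjoint [T^* : W^* -> V^*]. *)
Definition adjoint (T : bop V W) (phi : dual W) : dual V := bop_comp phi T.

Definition SOT := initial_topology (fun T : bop V W => T : {ptws V -> W}).
HB.instance Definition _ := Topological.on SOT.

Definition SOTstar := initial_topology (fun T : bop V W =>
  ((T : {ptws V -> W}), (adjoint T : {ptws dual W -> dual V}))).
HB.instance Definition _ := Topological.on SOTstar.

End OperatorTopologies.

Section OperatorConvergence.
Context {R : realType} {V W : normedModType R[i]}.
Implicit Types (F : set_system (bop V W)) (T : bop V W).

Lemma SOT_cvgE F T : Filter F ->
  F --> (T : SOT V W) <-> forall x, S x @[S --> F] --> T x.
Proof.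
move=> FF; apply: (iff_trans _ (@ptws_cvgE _ _ _ F (@bop_fun _ _ _) T FF)).
exact: (@initial_cvgE _ _ (fun T : bop V W => T : {ptws V -> W})).
Qed.

Lemma SOTstar_cvgE F T : Filter F ->
  F --> (T : SOTstar V W) <->
  (forall x, S x @[S --> F] --> T x) /\
  (forall phi, adjoint S phi @[S --> F] --> adjoint T phi).
Proof.
move=> FF; rewrite -(@ptws_cvgE _ _ _ F (@bop_fun _ _ _) T FF).
rewrite -(@ptws_cvgE _ _ _ F (@adjoint _ _ _) (adjoint T) FF).
apply: (iff_trans (@initial_cvgE _ _ (fun T : bop V W =>
  ((T : {ptws V -> W}), (adjoint T : {ptws dual W -> dual V}))) F T FF)).
exact: (@pair_cvgE _ _ {ptws V -> W} {ptws dual W -> dual V}).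
Qed.

End OperatorConvergence.

Definition comeager {T : topologicalType} (A : set T) :=
  exists G : set T, [/\ Gdelta G, dense G & G `<=` A].

(** A typical element of the subspace [A] of [X] satisfies [P]. *)
Definition typical {X : topologicalType} (A : set X) (P : X -> Prop) :=
  comeager [set x : A | P (set_val x)].

Section PositiveContractions.
Context {R : realType}.

Definition positive_vector (x : ell2 R) := forall n, 0 <= x n.

Definition positive_operator (T : bop (ell2 R) (ell2 R)) :=
  forall x, positive_vector x -> positive_vector (T x).

Definition P1 : set (bop (ell2 R) (ell2 R)) :=
  [set T | positive_operator T /\ `|T| <= 1].

End PositiveContractions.

Definition is_nontrivial_invariant_subspace {R : realType}
    {V : normedModType R[i]} (T : bop V V) (Y : set V) :=
  [/\ Y 0 /\ (forall (a : R[i]) x y, Y x -> Y y -> Y (a *: x + y)), closed Y,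
      Y <> [set 0], Y <> setT & T @` Y `<=` Y].

Definition has_nontrivial_invariant_subspace {R : realType}
    {V : normedModType R[i]} (T : bop V V) :=
  exists Y : set V, is_nontrivial_invariant_subspace T Y.

(* Main.v *)
From HB Require Import structures.
Require Import Defs.
From mathcomp Require Import all_boot all_order all_algebra.
From mathcomp Require Import complex ring lra zify.
From mathcomp Require Import all_classical all_reals all_analysis.

(** Let [<f, y> = \sum_i y_i f_i].  If [x] and [y] are nonzero and
    [<T^n x, y> = 0] for all [n >= 1], then the vectors [f] with
    [<T^n f, y> = 0] for all [n >= 1] form an invariant subspace, which is
    non-trivial unless [<T f, y>] vanishes identically, and then the kernel of
    [y] is one ([orthogonal_orbit_invariant]).  Typical positive contractions
    turn out to have such a pair, which is obtained by successive corrections.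

    The correction step.  Suppose that [<T^n x, y>] is tiny for [1 <= n < M] and
    that [T^M x] is tiny, for finitely supported [x] and [y].  In [SOT^*] the
    operator [T] is close to [r (B + S)], where [r < 1] is close to [1], [B] is
    [r P_N T P_N] with [P_N] the projection on the first [N] coordinates, and
    [S] is the backward shift of multiplicity [N + 1] on the other coordinates:
    this is again a positive contraction ([block_operator], [block_close]).
    Write [1 - B^* B = D^* D].  Then [f |-> (D B^k f)_k] is a contraction which
    intertwines [B] with a backward shift of multiplicity [N], and
    [\sum_k <D B^(k+n) p, D B^k q> = <B^n p, q>]: every matrix coefficient of
    [B] is a matrix coefficient of [S], for vectors no longer than [p] and [q].
    Positivity is preserved because [D] enters only into vectors, which may have
    any sign, and not into the operator.  For [p = B^M x], which is short, and after a
    delay by [M] levels of the shift, this gives short vectors [u] and [v] on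
    the coordinates of [S] with [<S^n u, v>] close to [- <B^n x, y>] for
    [n >= M]; the finitely many [n < M] are repaired exactly in the remaining
    channel of the shift ([dilation_correction], [tail_correction]).  Hence the
    orbit of [x + u] under the new operator is as orthogonal to [y + v] as
    desired, and since [r < 1] the powers of that operator tend to [0], which
    gives the hypotheses of the next step for a larger [M]
    ([improvable_dense]).

    Category.  The hypotheses of a step are finitely many strict inequalities
    between continuous functions of [T] for [SOT], and [x], [y] may be taken
    with Gaussian rational coordinates.  So the operators for which every step
    can be continued contain a countable intersection of sets that are open for
    [SOT] and dense for [SOT^*] ([generic_condition_SOT_open],
    [generic_condition_dense]).  Positive contractions form a Baire space for
    [SOT^*] ([baire_P1]), so the intersection is dense for [SOT^*], and a
    fortiori for the coarser topology [SOT].  For an operator [T] in the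
    intersection the steps can be iterated with [T] fixed; the corrections are
    summable, and in the limit one gets [x], and a bounded functional in the
    place of [y] ([improvable_invariant]). *)

Set Implicit Arguments.
Unset Strict Implicit.
Unset Printing Implicit Defensive.
Import Order.TTheory GRing.Theory Num.Theory.
Import numFieldNormedType.Exports.
Local Open Scope classical_set_scope.
Local Open Scope complex_scope.
Local Open Scope ring_scope.

(** * Complex scalars and quantitative limits *)

Section Scalars.
Context {R : realType}.

Lemma ler_rnorm_sum (V : normedZmodType R[i]) (I : Type) (s : seq I) (P : pred I) (F : I -> V) :
  rnorm (\sum_(i <- s | P i) F i) <= \sum_(i <- s | P i) rnorm (F i).
Proof.
elim/big_rec2: _ => [|i a v _ h]; first by rewrite rnorm0.
by apply: le_trans (ler_rnormD _ _) _; rewrite lerD2l.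
Qed.

Lemma rnormN (V : normedZmodType R[i]) (x : V) : rnorm (- x) = rnorm x.
Proof. by rewrite /rnorm normrN. Qed.

Lemma rnormB_sym (V : normedZmodType R[i]) (x y : V) : rnorm (x - y) = rnorm (y - x).
Proof. by rewrite -rnormN opprB. Qed.

Lemma rnorm_conj (z : R[i]) : rnorm (z^*)%C = rnorm z.
Proof. by rewrite /rnorm; case: z => a b /=; rewrite sqrrN. Qed.

Lemma mulr_conj (z : R[i]) : z * z^*%C = (rnorm z ^+ 2)%:C.
Proof. by rewrite rmorphXn /= rnormE sqr_normc. Qed.

Lemma cauchy_schwarz_sum (I : Type) (s : seq I) (a b : I -> R) :
  (forall i, 0 <= a i) -> (forall i, 0 <= b i) ->
  (\sum_(i <- s) a i * b i) ^+ 2 <=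
  (\sum_(i <- s) a i ^+ 2) * (\sum_(i <- s) b i ^+ 2).
Proof.
move=> a0 b0; elim: s => [|i s IH]; first by rewrite !big_nil expr0n mulr0.
rewrite !big_cons.
have P0 : 0 <= \sum_(j <- s) a j * b j by apply: sumr_ge0 => j _; exact: mulr_ge0.
have A0 : 0 <= \sum_(j <- s) a j ^+ 2 by apply: sumr_ge0 => j _; exact: sqr_ge0.
have B0 : 0 <= \sum_(j <- s) b j ^+ 2 by apply: sumr_ge0 => j _; exact: sqr_ge0.
move: P0 A0 B0 IH (a0 i) (b0 i).
move: (\sum_(j <- s) a j * b j) (\sum_(j <- s) a j ^+ 2) (\sum_(j <- s) b j ^+ 2).
move=> P A B P0 A0 B0 IH.
move: (a i) (b i) => {a b a0 b0 i} a b a0 b0.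
have cross : 2 * (P * (a * b)) <= A * b ^+ 2 + B * a ^+ 2.
  rewrite -(@ler_pXn2r _ 2) // ?nnegrE ?addr_ge0 ?mulr_ge0 ?sqr_ge0 //.
  apply: (@le_trans _ _ (4 * (A * B) * (a * b) ^+ 2)).
    have -> : (2 * (P * (a * b))) ^+ 2 = 4 * P ^+ 2 * (a * b) ^+ 2 by ring.
    by rewrite ler_wpM2r ?sqr_ge0 // ler_pM2l.
  have := sqr_ge0 (A * b ^+ 2 - B * a ^+ 2); nra.
by nra.
Qed.

End Scalars.

Section Limits.
Context {R : realType}.

Lemma ler_rnorm_Re (z : R[i]) : `|complex.Re z| <= rnorm z.
Proof. by rewrite -lecR rnormE normc_ge_Re. Qed.

Lemma ler_rnorm_Im (z : R[i]) : `|complex.Im z| <= rnorm z.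
Proof.
by rewrite /rnorm normc_def /= -sqrtr_sqr ler_wsqrtr // lerDr sqr_ge0.
Qed.

Lemma rnorm_le_ReIm (z : R[i]) : rnorm z <= `|complex.Re z| + `|complex.Im z|.
Proof.
rewrite {1}[z]complexE; apply: le_trans (ler_rnormD _ _) _.
rewrite rnorm_real rnormM rnorm_real lerD2l.
by rewrite /rnorm normc_def /= expr0n expr1n /= add0r sqrtr1 mul1r.
Qed.

(** The limit is the supremum of the lower bounds [a j - c j], all of which lie
    below all the upper bounds [a j + c j]. *)
Lemma real_cauchy_limit (a c : nat -> R) :
  (forall j l, (j <= l)%N -> `|a l - a j| <= c j) ->
  exists v, forall j, `|v - a j| <= c j.
Proof.
move=> ac; pose A := [set a j - c j | j in [set: nat]].
have ub j l : a l - c l <= a j + c j.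
  have := ac j (maxn j l) (leq_maxl _ _); have := ac l (maxn j l) (leq_maxr _ _).
  by rewrite !ler_norml => /andP[h1 _] /andP[_ h2]; lra.
have A0 : A !=set0 by exists (a 0%N - c 0%N), 0%N.
have Ab : has_ubound A by exists (a 0%N + c 0%N) => _ [l _ <-]; exact: ub.
exists (sup A) => j; rewrite ler_norml; apply/andP; split.
  by rewrite lerBrDr addrC; apply: ub_le_sup => //; exists j.
by rewrite lerBlDr addrC; apply: ge_sup => // _ [l _ <-]; exact: ub.
Qed.

(** A limit in [R[i]] together with the rate [c], from order completeness in
    each coordinate: this costs a factor, which is removed by comparing with a
    later term. *)
Lemma cauchy_limit (u : nat -> R[i]) (c : nat -> R) :
  (forall j l, (j <= l)%N -> rnorm (u l - u j) <= c j) ->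
  (forall e, 0 < e -> exists j, c j <= e) ->
  exists v, forall j, rnorm (v - u j) <= c j.
Proof.
move=> uc c0.
have [|a av] := @real_cauchy_limit (fun j => complex.Re (u j)) c.
  move=> j l jl; apply: le_trans (uc j l jl); rewrite -raddfB; exact: ler_rnorm_Re.
have [|b bv] := @real_cauchy_limit (fun j => complex.Im (u j)) c.
  move=> j l jl; apply: le_trans (uc j l jl); rewrite -raddfB; exact: ler_rnorm_Im.
pose v := a +i* b; exists v => j.
have v2 l : rnorm (v - u l) <= c l + c l.
  apply: le_trans (rnorm_le_ReIm _) _; rewrite !raddfB /=; exact: lerD.
have cge0 l : 0 <= c l by apply: le_trans (uc l l (leqnn l)); exact: rnorm_ge0.
apply/ler_addgt0Pr => e e0.
have [l cl] := c0 (e / 3) (divr_gt0 e0 (ltr0Sn _ _)).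
have -> : v - u j = (v - u l) + (u l - u j) by ring.
apply: le_trans (ler_rnormD _ _) _; have := v2 l.
have [/(uc j l)|/ltnW /(uc l j)] := leqP j l; last rewrite rnormB_sym; have := cge0 j; lra.
Qed.

Lemma le_small0 (a : R) : (forall e, 0 < e -> a <= e) -> a <= 0.
Proof. by move=> h; apply/ler_addgt0Pr => e /h; rewrite add0r. Qed.

Lemma rnorm_small0 (V : normedZmodType R[i]) (x : V) :
  (forall e, 0 < e -> rnorm x <= e) -> x = 0.
Proof.
by move=> /le_small0 h; apply: rnorm0_eq0; apply/eqP; rewrite eq_le h rnorm_ge0.
Qed.

Lemma cvg_rnormP (V : normedModType R[i]) (T : Type) (F : set_system T)
    (f : T -> V) (l : V) : Filter F ->
  f @ F --> l <-> forall e : R, 0 < e -> \forall t \near F, rnorm (f t - l) < e.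
Proof.
move=> FF; split=> [/cvgrPdist_lt h e e0|h].
  have e0' : 0 < e%:C by rewrite ltcR.
  apply: filterS (h _ e0') => t; rewrite -rnormE ltcR; by rewrite rnormB_sym.
apply/cvgrPdist_lt => e e0.
have er : e = (complex.Re e)%:C by rewrite RRe_real // gtr0_real.
have e0' : 0 < complex.Re e by rewrite -ltcR -er.
by apply: filterS (h _ e0') => t; rewrite er -rnormE ltcR rnormB_sym.
Qed.

End Limits.

Lemma geometric_small (R : realType) (r c e : R) : 0 <= r -> r < 1 -> 0 < e ->
  exists J, r ^+ J * c <= e.
Proof.
move=> r0 r1 e0.
have h : (fun n => r ^+ n * c) @ \oo --> (0 : R).
  rewrite -(mul0r c); apply: cvgMl; apply: cvg_expr; by rewrite ger0_norm.
have /cvgrPdist_le /(_ _ e0) [J _ /(_ J (leqnn J))] := h.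
by rewrite /= sub0r normrN => /(le_trans (ler_norm _)) ?; exists J.
Qed.

Section Powers.
Context {R : realType}.

Lemma half_pow_small (c e : R) : 0 < e -> exists J, 2 ^- J * c <= e.
Proof.
move=> e0; have [||J] := @geometric_small R 2^-1 c e _ _ e0.
- by rewrite invr_ge0.
- by rewrite invf_lt1 // ltr1n.
by rewrite exprVn; exists J.
Qed.

Lemma half_pow_le j k : (j <= k)%N -> 2 ^- k <= 2 ^- j :> R.
Proof. by move=> jk; rewrite lef_pV2 ?posrE ?exprn_gt0 // ler_eXn2l // ltr1n. Qed.

Lemma half_powS k : 2 ^- k.+1 + 2 ^- k.+1 = 2 ^- k :> R.
Proof. by rewrite exprS invfM; lra. Qed.

Lemma half_pow_gt0 k : 0 < 2 ^- k :> R.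
Proof. by rewrite invr_gt0 exprn_gt0. Qed.


(** Both sides are compared through the geometric sum [1 + r + ... + r^m],
    whose terms are all at least [r^m]. *)
Lemma succ_geometric_le (r : R) m : 0 <= r -> r <= 1 ->
  m.+1%:R * r ^+ m * (1 - r) <= 1 - r ^+ m.+1.
Proof.
move=> r0 r1; elim: m => [|m IH]; first by rewrite expr0 !mulr1 mul1r.
have rm : r ^+ m.+1 <= 1 by rewrite exprn_ile1.
rewrite [r ^+ m.+2]exprS -[m.+2]addn1 natrD.
have -> : (m.+1%:R + 1) * r ^+ m.+1 * (1 - r) =
  r * (m.+1%:R * r ^+ m * (1 - r)) + r ^+ m.+1 * (1 - r) by rewrite exprS; ring.
have := ler_wpM2l r0 IH.
move: (r ^+ m.+1) rm (m.+1%:R * _ * _) => s s1 z; nra.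
Qed.

Lemma poly_geometric_small (r c e : R) : 0 <= r -> r < 1 -> 0 < e ->
  exists M, r ^+ M * M.+1%:R ^+ 2 * c < e.
Proof.
move=> r0 r1 e0.
have c1 : 0 < 1 - r by rewrite subr_gt0.
pose K := 9 * ((1 - r) ^- 2) * `|c|.
have e2 : 0 < e / 2 by rewrite divr_gt0.
have [m hm] := @geometric_small R r K _ r0 r1 e2.
(* Two factors [r ^+ m] absorb the square, the third one is small. *)
exists (3 * m)%N; apply: (@le_lt_trans _ _ (e / 2)); last by lra.
apply: le_trans hm; rewrite /K.
apply: (@le_trans _ _ (r ^+ (3 * m) * (3 * m).+1%:R ^+ 2 * `|c|)).
  by rewrite ler_wpM2l ?ler_norm // mulr_ge0 ?exprn_ge0.
rewrite [leRHS]mulrA ler_wpM2r ?normr_ge0 //.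
have h : m.+1%:R * r ^+ m <= (1 - r)^-1.
  rewrite -div1r ler_pdivlMr //; apply: le_trans (succ_geometric_le m r0 (ltW r1)) _.
  by rewrite gerBl exprn_ge0.
have h2 : (3 * m).+1%:R <= 3 * m.+1%:R :> R by rewrite -natrM ler_nat; lia.
have -> : r ^+ (3 * m) = r ^+ m * (r ^+ m) ^+ 2 by rewrite -exprM -exprD; congr (_ ^+ _); lia.
rewrite -mulrA; apply: ler_wpM2l; first exact: exprn_ge0.
rewrite -exprMn -exprVn (_ : 9 = 3 ^+ 2 :> R); last by rewrite -natrX.
rewrite -exprMn ler_pXn2r ?nnegrE ?mulr_ge0 ?exprn_ge0 ?invr_ge0 ?(ltW c1) //.
apply: (@le_trans _ _ (r ^+ m * (3 * m.+1%:R))); first by rewrite ler_wpM2l ?exprn_ge0.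
by rewrite mulrCA ler_wpM2l // mulrC.
Qed.

End Powers.

(** * The sequence space *)

Section Ell2Basics.
Context {R : realType}.
Notation C := R[i].
Notation H := (ell2 R).
Implicit Types (x y : H) (f g : nat -> C).

Lemma rnorm_ell2 x : rnorm x = seq_norm2 x.
Proof. by []. Qed.

Lemma ell2_sqr_sum_le x n : \sum_(0 <= i < n) rnorm (x i) ^+ 2 <= rnorm x ^+ 2.
Proof.
have := sqnorm_partial_le (Defs.coordP x) n; rewrite -rnorm_ell2.
by rewrite -(@ler_pXn2r _ 2) ?nnegrE ?sqrtr_ge0 ?rnorm_ge0 // sqr_sqrtr ?sqnorm_partial_ge0.
Qed.

Lemma ell2_make f (K : R) : 0 <= K ->
  (forall n, \sum_(0 <= i < n) rnorm (f i) ^+ 2 <= K ^+ 2) ->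
  exists2 x : H, (forall i, x i = f i) & rnorm x <= K.
Proof.
move=> K0 fK; have [|fs fn] := @square_summable_bound R f K.
  by move=> n; rewrite -[leRHS]ger0_norm // -sqrtr_sqr; apply: ler_wsqrtr; exact: fK.
by exists (Ell2 fs).
Qed.

Lemma ell2P x y : (forall i, x i = y i) -> x = y.
Proof. by move=> h; apply/val_inj/funext => i; exact: h. Qed.

Lemma rnorm_ell2_le x (K : R) : 0 <= K ->
  (forall n, \sum_(0 <= i < n) rnorm (x i) ^+ 2 <= K ^+ 2) -> rnorm x <= K.
Proof. by move=> K0 /(ell2_make K0)[y yx]; rewrite (ell2P yx). Qed.

Lemma ler_rnorm_coord x i : rnorm (x i) <= rnorm x.
Proof.
rewrite -(@ler_pXn2r _ 2) ?nnegrE ?rnorm_ge0 //.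
apply: le_trans (ell2_sqr_sum_le x i.+1).
by rewrite big_nat_recr //= lerDr sumr_ge0 // => j _; exact: sqr_ge0.
Qed.

Lemma coordD x y i : (x + y) i = x i + y i. Proof. by []. Qed.
Lemma coordN x i : (- x) i = - x i. Proof. by []. Qed.
Lemma coordB x y i : (x - y) i = x i - y i. Proof. by []. Qed.
Lemma coordZ (a : C) x i : (a *: x) i = a * x i. Proof. by []. Qed.
Lemma coord0 i : (0 : H) i = 0. Proof. by []. Qed.
Lemma coord_sum (I : Type) (s : seq I) (F : I -> H) i :
  (\sum_(j <- s) F j) i = \sum_(j <- s) F j i.
Proof. by elim: s => [|j s IH]; rewrite ?big_nil ?big_cons ?coordD ?IH. Qed.

Lemma cut_summable N f :
  (fun i => if (i < N)%N then f i else 0) \in @square_summable R.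
Proof.
have [||x xE _] := @ell2_make (fun i => if (i < N)%N then f i else 0)
  (1 + \sum_(0 <= i < N) rnorm (f i) ^+ 2).
- by rewrite addr_ge0 // sumr_ge0 // => j _; exact: sqr_ge0.
- move=> n; set S := \sum_(0 <= i < N) _.
  have S0 : 0 <= S by rewrite sumr_ge0 // => j _; exact: sqr_ge0.
  apply: (@le_trans _ _ S); last by nra.
  apply: (@le_trans _ _ (\sum_(0 <= i < n + N)
      rnorm (if (i < N)%N then f i else 0) ^+ 2)).
    rewrite [leRHS](big_cat_nat (n := n)) ?leq_addr //= lerDl sumr_ge0 // => j _.
    exact: sqr_ge0.
  rewrite (big_cat_nat (n := N)) ?leq_addl //=.
  rewrite [X in _ + X]big_nat [X in _ + X]big1 ?addr0 => [|j /andP[Nj _]].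
    by rewrite le_eqVlt; apply/orP; left; apply/eqP/eq_big_nat => j /andP[_ ->].
  by rewrite ltnNge Nj /= rnorm0 expr0n.
have -> : (fun i => if (i < N)%N then f i else 0) = Defs.coord x.
  by apply/funext => i; rewrite xE.
exact: Defs.coordP.
Qed.

Definition cut N f : H := Ell2 (cut_summable N f).

Lemma cutE N f i : cut N f i = if (i < N)%N then f i else 0.
Proof. by []. Qed.

Lemma cutD N f g : cut N (f + g) = cut N f + cut N g.
Proof.
by apply: ell2P => i; rewrite coordD !cutE; case: ifP => //; rewrite addr0.
Qed.

Lemma cutZ N (a : C) f : cut N (fun i => a * f i) = a *: cut N f.
Proof.
by apply: ell2P => i; rewrite coordZ !cutE; case: ifP => //; rewrite mulr0.
Qed.

Lemma eq_cut N f g : (forall i, (i < N)%N -> f i = g i) -> cut N f = cut N g.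
Proof. by move=> h; apply: ell2P => i; rewrite !cutE; case: ifP => // /h. Qed.

Lemma sqr_rnorm_cut N f :
  rnorm (cut N f) ^+ 2 = \sum_(0 <= i < N) rnorm (f i) ^+ 2.
Proof.
apply/eqP; rewrite eq_le; apply/andP; split; last first.
  apply: le_trans (ell2_sqr_sum_le (cut N f) N).
  by rewrite le_eqVlt; apply/orP; left; apply/eqP/eq_big_nat => j /andP[_ jN]; rewrite /= jN.
set S := \sum_(_ <= _ < _) _.
have S0 : 0 <= S by rewrite sumr_ge0 // => j _; exact: sqr_ge0.
rewrite -[leRHS]sqr_sqrtr // ler_pXn2r ?nnegrE ?rnorm_ge0 ?sqrtr_ge0 //.
apply: rnorm_ell2_le; rewrite ?sqrtr_ge0 // => n; rewrite sqr_sqrtr //.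
apply: (@le_trans _ _ (\sum_(0 <= i < n + N) rnorm (cut N f i) ^+ 2)).
  rewrite [leRHS](big_cat_nat (n := n)) ?leq_addr //= lerDl sumr_ge0 // => j _.
  exact: sqr_ge0.
rewrite (big_cat_nat (n := N)) ?leq_addl //=.
rewrite [X in _ + X]big_nat [X in _ + X]big1 ?addr0 => [|j /andP[Nj _]].
  by rewrite le_eqVlt; apply/orP; left; apply/eqP/eq_big_nat => j /andP[_ jN]; rewrite /= jN.
by rewrite /= ltnNge Nj /= rnorm0 expr0n.
Qed.

Lemma ler_rnorm_cut N x : rnorm (cut N x) <= rnorm x.
Proof.
by rewrite -(@ler_pXn2r _ 2) ?nnegrE ?rnorm_ge0 // sqr_rnorm_cut ell2_sqr_sum_le.
Qed.

Lemma cut_approx x (e : R) : 0 < e ->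
  exists N, forall n, (N <= n)%N -> rnorm (x - cut n x) <= e.
Proof.
move=> e0.
have cx : (fun n => \sum_(0 <= i < n) rnorm (x i) ^+ 2) @ \oo --> rnorm x ^+ 2.
  rewrite rnorm_ell2 /seq_norm2 sqr_sqrtr.
    by have /asboolP := Defs.coordP x.
  apply: limr_ge; first by have /asboolP := Defs.coordP x.
  by apply: nearW => n; exact: sqnorm_partial_ge0.
have e20 : 0 < e ^+ 2 by rewrite exprn_gt0.
have /cvgrPdist_le /(_ _ e20) [N _ hN] := cx.
exists N => n Nn; have := hN n Nn.
rewrite /= => /(le_trans (ler_norm _)) {}hn.
apply: rnorm_ell2_le; first exact: ltW.
move=> m; apply: le_trans hn; rewrite lerBrDl.
apply: le_trans (ell2_sqr_sum_le x (n + m)).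
rewrite [leRHS](big_cat_nat (n := n)) ?leq_addr //= lerD2l.
apply: (@le_trans _ _ (\sum_(0 <= i < n + m) rnorm ((x - cut n x) i) ^+ 2)).
  rewrite [leRHS](big_cat_nat (n := m)) ?leq_addl //= lerDl sumr_ge0 // => j _.
  exact: sqr_ge0.
rewrite (big_cat_nat (n := n)) ?leq_addr //.
rewrite [X in X + _ <= _]big_nat [X in X + _ <= _]big1 ?add0r => [|j /andP[_ jn]].
  rewrite le_eqVlt; apply/orP; left; apply/eqP/eq_big_nat => j /andP[nj _].
  by rewrite coordB cutE ltnNge nj /= subr0.
by rewrite coordB cutE jn subrr rnorm0 expr0n.
Qed.

Definition basis i : H := cut i.+1 (fun j => (j == i)%:R).

Lemma basisE i j : basis i j = (j == i)%:R.
Proof.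
rewrite /basis cutE; case: ltnP => // ij.
by rewrite gtn_eqF.
Qed.

Lemma rnorm_basis i : rnorm (basis i) = 1.
Proof.
apply/eqP; rewrite -(@eqrXn2 _ 2) ?rnorm_ge0 // expr1n sqr_rnorm_cut.
rewrite big_nat_recr //= eqxx big_nat big1 => [|j /andP[_ ji]].
  by rewrite add0r /rnorm normr1 expr1n.
by rewrite ltn_eqF // rnorm0 expr0n.
Qed.

Lemma cut_basis N f : cut N f = \sum_(0 <= i < N) f i *: basis i.
Proof.
apply: ell2P => j; rewrite coord_sum cutE.
under eq_bigr do rewrite coordZ basisE.
elim: N => [|N IH]; first by rewrite big_geq.
rewrite big_nat_recr //= -IH ltnS leq_eqVlt; have [->|jN] := eqVneq j N.
  by rewrite ltnn add0r mulr1.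
by rewrite mulr0 addr0.
Qed.

Lemma rnorm_cut_le_sum N f : rnorm (cut N f) <= \sum_(0 <= i < N) rnorm (f i).
Proof.
rewrite cut_basis; apply: le_trans (ler_rnorm_sum _ _ _) _.
by apply: ler_sum => i _; rewrite rnormZ rnorm_basis mulr1.
Qed.

(** Fatou's lemma for the counting measure.  It serves as completeness of
    [ell2], because limits are always first constructed coordinatewise. *)
Lemma ell2_fatou (a : nat -> H) g (K : R) : 0 <= K ->
  (forall l, rnorm (a l) <= K) ->
  (forall i e, 0 < e -> exists L, forall l, (L <= l)%N -> rnorm (g i - a l i) <= e) ->
  exists2 x : H, (forall i, x i = g i) & rnorm x <= K.
Proof.
move=> K0 aK ag; apply: ell2_make => // n.
have h m e : 0 < e -> exists L, forall l i, (L <= l)%N -> (i < m)%N ->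
    rnorm (g i - a l i) <= e.
  move=> e0; elim: m => [|m [L hL]]; first by exists 0%N.
  have [L' hL'] := ag m e e0; exists (maxn L L') => l i.
  rewrite geq_max ltnS => /andP[Ll L'l]; rewrite leq_eqVlt => /orP[/eqP ->|im].
    exact: hL'.
  exact: hL.
rewrite -sqr_rnorm_cut ler_pXn2r ?nnegrE ?rnorm_ge0 //.
apply/ler_addgt0Pr => e e0.
have e0' : 0 < e / n.+1%:R by rewrite divr_gt0.
have [L /(_ L _ (leqnn L)) hL] := h n _ e0'.
have -> : cut n g = cut n (a L) + cut n (fun i => g i - a L i).
  by rewrite -cutD; apply: eq_cut => i _; rewrite /= addrC subrK.
apply: le_trans (ler_rnormD _ _) _; apply: lerD.
  exact: le_trans (ler_rnorm_cut _ _) (aK L).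
apply: le_trans (rnorm_cut_le_sum _ _) _.
apply: (@le_trans _ _ (\sum_(0 <= i < n) e / n.+1%:R)).
  by rewrite !big_nat; apply: ler_sum => i /andP[_ /hL].
rewrite sumr_const_nat subn0 -[_ *+ n]mulr_natr -mulrA ler_piMr ?(ltW e0) //.
by rewrite mulrC ler_pdivrMr // mul1r ler_nat.
Qed.

End Ell2Basics.

(** * Pairings and functionals *)

Section Pairing.
Context {R : realType}.
Notation C := R[i].
Notation H := (ell2 R).

(** Bilinear, without conjugation: the functional defined by [y] depends linearly
    on [y]. *)
Definition pair (N : nat) (y f : nat -> C) : C := \sum_(0 <= i < N) y i * f i.

Lemma pair_le_cut N (y f : nat -> C) :
  rnorm (pair N y f) <= rnorm (cut N y) * rnorm (cut N f).
Proof.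
rewrite -(@ler_pXn2r _ 2) // ?nnegrE ?mulr_ge0 ?rnorm_ge0 //.
rewrite exprMn !sqr_rnorm_cut.
apply: le_trans (cauchy_schwarz_sum _ (fun i => rnorm_ge0 (y i)) (fun i => rnorm_ge0 (f i))).
rewrite ler_pXn2r ?nnegrE ?rnorm_ge0 ?sumr_ge0 // => [|i _]; last first.
  by rewrite mulr_ge0 ?rnorm_ge0.
apply: le_trans (ler_rnorm_sum _ _ _) _; apply: ler_sum => i _.
by rewrite rnormM.
Qed.

Lemma pair_le N (y f : H) : rnorm (pair N y f) <= rnorm y * rnorm f.
Proof.
by apply: le_trans (pair_le_cut _ _ _) _; rewrite ler_pM ?rnorm_ge0 ?ler_rnorm_cut.
Qed.

Lemma pairDr N (y : nat -> C) (f g : H) : pair N y (f + g) = pair N y f + pair N y g.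
Proof. by rewrite -big_split; apply: eq_bigr => i _; rewrite coordD mulrDr. Qed.

Lemma pairDl N (y z f : H) : pair N (y + z : H) f = pair N y f + pair N z f.
Proof. by rewrite -big_split; apply: eq_bigr => i _; rewrite coordD mulrDl. Qed.

Lemma pairZr N (y : nat -> C) (a : C) (f : H) : pair N y (a *: f) = a * pair N y f.
Proof.
by rewrite /pair mulr_sumr; apply: eq_bigr => i _; rewrite coordZ mulrCA.
Qed.

Lemma pairBr N (y : nat -> C) (f g : H) : pair N y (f - g) = pair N y f - pair N y g.
Proof. by rewrite pairDr -scaleN1r pairZr mulN1r. Qed.

Lemma pairBl N (y z f : H) : pair N (y - z : H) f = pair N y f - pair N z f.
Proof.
rewrite pairDl; congr (_ + _); rewrite /pair -sumrN; apply: eq_bigr => i _.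
by rewrite coordN mulNr.
Qed.

Lemma pair_support N K (y f : nat -> C) : (N <= K)%N ->
  (forall i, (N <= i)%N -> y i = 0) -> pair K y f = pair N y f.
Proof.
move=> NK y0; rewrite /pair (big_cat_nat (n := N)) //=.
rewrite [X in _ + X]big_nat [X in _ + X]big1 ?addr0 // => i /andP[/y0 -> _].
by rewrite mul0r.
Qed.

End Pairing.

Section Functionals.
Context {R : realType}.
Notation C := R[i].
Notation H := (ell2 R).

Lemma linear_cut (W : lmodType C) (phi : H -> W) N (f : nat -> C) : linear phi ->
  phi (cut N f) = \sum_(0 <= i < N) f i *: phi (basis i).
Proof.
move=> lp; pose L := GRing.isLinear.Build C H W *:%R phi lp.
pose phi' : {linear H -> W} := HB.pack phi L.
rewrite cut_basis -[phi]/(phi' : H -> W) linear_sum.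
by apply: eq_bigr => i _; rewrite linearZ.
Qed.

Lemma linearBf (V W : lmodType C) (phi : V -> W) (x y : V) : linear phi ->
  phi (x - y) = phi x - phi y.
Proof.
move=> lp; rewrite -scaleN1r addrC lp scaleN1r addrC //.
Qed.

(** The coefficients [phi (basis i)] are square summable, as one sees by testing
    [phi] against their conjugates, and the Cauchy-Schwarz inequality bounds the
    tail.  This is the part of the Riesz representation theorem which makes the
    rows of an operator control its adjoint. *)
Lemma functional_tail (phi : H -> C^o) (K e : R) : linear phi -> 0 <= K ->
  (forall x, rnorm (phi x) <= K * rnorm x) -> 0 < e ->
  exists N, forall n, (N <= n)%N ->
    forall x : H, rnorm (phi (x - cut n x)) <= e * rnorm x.
Proof.
move=> lp K0 phiK e0.
pose a i : C := phi (basis i).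
have phi_cut N f : phi (cut N f) = pair N f a.
  by rewrite linear_cut //; apply: eq_bigr => i _; rewrite /a.
have [|A AE AK] := ell2_make (f := a) K0.
  move=> n; pose z := cut n (fun i => (a i)^*%C).
  have zE : rnorm z ^+ 2 = \sum_(0 <= i < n) rnorm (a i) ^+ 2.
    by rewrite sqr_rnorm_cut; apply: eq_bigr => i _; rewrite rnorm_conj.
  have := phiK z; rewrite phi_cut.
  have -> : pair n (fun i => (a i)^*%C) a = (rnorm z ^+ 2)%:C.
    by rewrite zE rmorph_sum; apply: eq_bigr => i _; rewrite mulrC mulr_conj.
  rewrite rnorm_real ger0_norm ?sqr_ge0 // -zE => h.
  have [z0|z0] := eqVneq (rnorm z) 0; first by rewrite z0 expr0n sqr_ge0.
  have z_gt0 : 0 < rnorm z by rewrite lt_neqAle eq_sym z0 rnorm_ge0.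
  rewrite ler_pXn2r ?nnegrE ?rnorm_ge0 //.
  by rewrite -(ler_pM2r z_gt0) -expr2.
have [N hN] := cut_approx A e0; exists N => n Nn x.
pose y : H := x - cut n x; rewrite -/y.
apply/ler_addgt0Pr => d d0.
have d0' : 0 < d / (K + 1) by rewrite divr_gt0 // ltr_wpDl.
have [m /(_ m (leqnn m)) hm] := cut_approx y d0'.
have -> : phi y = phi (cut m y) + phi (y - cut m y).
  by rewrite (linearBf y (cut m y) lp) addrC subrK.
apply: le_trans (ler_rnormD _ _) _; apply: lerD; last first.
  apply: le_trans (phiK _) _; apply: le_trans (ler_wpM2l K0 hm) _.
  by rewrite mulrCA ler_piMr ?(ltW d0) // ler_pdivrMr ?ltr_wpDl // mul1r lerDl.
rewrite phi_cut.
have -> : pair m y a = pair m (A - cut n A : H) x.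
  apply: eq_bigr => i _; rewrite /y !coordB !cutE AE.
  by case: ifP => _; rewrite ?subrr ?subr0 ?mul0r // mulrC.
apply: le_trans (pair_le _ _ _) _; rewrite ler_wpM2r ?rnorm_ge0 //; exact: hN.
Qed.

Lemma limit_linear (V : lmodType C) (u : nat -> V -> C^o) (t : V -> C^o) :
  (forall l, linear (u l)) ->
  (forall f e, 0 < e -> exists L, forall l, (L <= l)%N -> rnorm (t f - u l f) <= e) ->
  linear t.
Proof.
move=> ul tu a x y; apply/eqP; rewrite -subr_eq0; apply/eqP/rnorm_small0 => e e0.
have a1 : 0 < 3 * (1 + rnorm a) by rewrite mulr_gt0 // ltr_pwDl ?rnorm_ge0.
have e3 : 0 < e / (3 * (1 + rnorm a)) by rewrite divr_gt0.
have [L1 h1] := tu (a *: x + y) _ e3.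
have [L2 h2] := tu x _ e3; have [L3 h3] := tu y _ e3.
pose l := maxn L1 (maxn L2 L3).
have {}h1 := h1 l (leq_maxl _ _).
have {}h2 := h2 l (leq_trans (leq_maxl _ _) (leq_maxr _ _)).
have {}h3 := h3 l (leq_trans (leq_maxr _ _) (leq_maxr _ _)).
set d := e / _ in e3 h1 h2 h3.
have -> : t (a *: x + y) - (a *: t x + t y) =
    (t (a *: x + y) - u l (a *: x + y)) - a * (t x - u l x) - (t y - u l y).
  by rewrite ul /GRing.scale /=; ring.
have h4 : rnorm (a * (t x - u l x)) <= rnorm a * d.
  by rewrite rnormM ler_wpM2l ?rnorm_ge0.
apply: le_trans (ler_rnormD _ _) _; rewrite rnormN.
apply: le_trans (lerD (ler_rnormD _ _) h3) _; rewrite rnormN.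
apply: (@le_trans _ _ (d + rnorm a * d + d)); first by rewrite !lerD.
have -> : e = d * (3 * (1 + rnorm a)) by rewrite divfK // gt_eqF.
have := rnorm_ge0 a; nra.
Qed.

End Functionals.

(** * Positive contractions and the strong-star topology *)

Section PositiveContractions.
Context {R : realType}.
Notation C := R[i].
Notation H := (ell2 R).
Notation bH := (bop H H).
Implicit Types (S T : bH) (x f : H).

Lemma rnorm_bop (V W : normedModType C) (T : bop V W) : rnorm T = opnorm T.
Proof. by []. Qed.

Lemma P1_contraction T : P1 T -> forall x, rnorm (T x) <= rnorm x.
Proof.
move=> [_ T1] x; apply: le_trans (le_opnorm (bopP T) x) _.
rewrite ler_piMl ?rnorm_ge0 // -rnorm_bop -lecR rnormE; exact: T1.
Qed.

Lemma rnorm_bop_le (V W : normedModType C) (T : bop V W) (K : R) : 0 <= K ->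
  (forall v : V, rnorm (T v) <= K * rnorm v) -> rnorm T <= K.
Proof.
by move=> K0 h; have [] := opnorm_le (bounded_linear_linear (bopP T)) K0 h.
Qed.

Lemma bop_linear T : linear T. Proof. exact: bounded_linear_linear (bopP T). Qed.

Lemma P1_make (F : H -> H) : linear F -> (forall x, rnorm (F x) <= rnorm x) ->
  (forall x, positive_vector x -> positive_vector (F x)) ->
  exists2 T, P1 T & forall x, T x = F x.
Proof.
move=> Fl F1 Fp; have [|Fb FN] := @opnorm_le R H H F 1 Fl ler01.
  by move=> x; rewrite mul1r.
exists (Bop Fb) => //; split; first exact: Fp.
rewrite -rnormE -[1]/(1%:C) lecR; exact: FN.
Qed.

Lemma P1_iter T n : P1 T -> forall x, rnorm (iter n T x) <= rnorm x.
Proof.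
move=> T1 x; elim: n => //= n; apply: le_trans; exact: P1_contraction.
Qed.

(** Columns control [SOT]; rows, as functionals, control the adjoints.  These
    balls replace a metric for [SOT^*] on the contractions. *)
Definition close (k : nat) (d : R) S T := forall i, (i < k)%N ->
  (forall f, rnorm (S f i - T f i) <= d * rnorm f) /\
  rnorm (S (basis i) - T (basis i)) <= d.

Lemma close_trans k d d' S T U : close k d S T -> close k d' T U ->
  close k (d + d') S U.
Proof.
move=> ST TU i ik; have [STr STc] := ST i ik; have [TUr TUc] := TU i ik.
split=> [f|].
  have -> : S f i - U f i = (S f i - T f i) + (T f i - U f i) by ring.
  by apply: le_trans (ler_rnormD _ _) _; rewrite mulrDl lerD.
rewrite -[S _](subrK (T (basis i))) -addrA.
by apply: le_trans (ler_rnormD _ _) _; rewrite lerD.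
Qed.

Lemma closeW k k' d d' S T : (k' <= k)%N -> d <= d' -> close k d S T ->
  close k' d' S T.
Proof.
move=> kk dd h i ik; have [hr hc] := h i (leq_trans ik kk).
split=> [f|]; last exact: le_trans hc dd.
by apply: le_trans (hr f) _; rewrite ler_wpM2r ?rnorm_ge0.
Qed.

(** On contractions, convergence of the rows and of the columns is enough since
    finitely supported vectors and functionals are dense. *)
Lemma close_SOTstar (S : nat -> bH) T : P1 T -> (forall k, P1 (S k)) ->
  (forall k, close k (2 ^- k) (S k) T) ->
  S @ \oo --> (T : SOTstar H H).
Proof.
move=> T1 S1 ST; apply/SOTstar_cvgE.
have small (c e : R) : 0 < e -> \forall k \near \oo, 2 ^- k * c <= e.
  move=> e0; have h : (fun n => 2^-1 ^+ n * c) @ \oo --> (0 : R).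
    rewrite -(mul0r c); apply: cvgMl; apply: cvg_expr.
    by rewrite ger0_norm ?invr_ge0 // invf_lt1 // ltr1n.
  have /cvgrPdist_le /(_ _ e0) := h; apply: filterS => k.
  by rewrite sub0r normrN exprVn; exact: le_trans (ler_norm _).
have Dl k : linear (fun v => S k v - T v).
  by move=> c u v; rewrite !bop_linear scalerBr opprD addrACA.
have D2 k v : rnorm (S k v - T v) <= 2 * rnorm v.
  apply: le_trans (ler_rnormD _ _) _; rewrite rnormN mulr_natl mulr2n.
  by apply: lerD; exact: P1_contraction.
split=> [x|phi]; apply/cvg_rnormP => e e0; have e4 : 0 < e / 4 by rewrite divr_gt0.
- have [N /(_ N (leqnn N)) hN] := cut_approx x e4.
  have sm := small (\sum_(0 <= i < N) rnorm (x i)) _ e4.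
  change (\forall k \near \oo, rnorm (S k x - T x) < e).
  near=> k; have Nk : (N <= k)%N by near: k; exists N.
  have -> : S k x - T x = S k (x - cut N x) - T (x - cut N x) +
      (S k (cut N x) - T (cut N x)).
    by rewrite (linearBf _ _ (Dl k)) subrK.
  apply: le_lt_trans (ler_rnormD _ _) _.
  have h1 : rnorm (S k (cut N x) - T (cut N x)) <= e / 4.
    rewrite (linear_cut _ _ (Dl k)).
    apply: le_trans (ler_rnorm_sum _ _ _) _.
    apply: (@le_trans _ _ (2 ^- k * \sum_(0 <= i < N) rnorm (x i))); last by near: k.
    rewrite mulr_sumr !big_nat; apply: ler_sum => i /andP[_ iN].
    rewrite rnormZ mulrC ler_wpM2r ?rnorm_ge0 //.
    by have [] := ST k i (leq_trans iN Nk).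
  have h2 := D2 k (x - cut N x); lra.
have e8 : 0 < e / 8 by rewrite divr_gt0.
have K0 : 0 <= rnorm phi := rnorm_ge0 _.
have [N /(_ N (leqnn N)) hN] := functional_tail (bounded_linear_linear (bopP phi)) K0
  (le_opnorm (bopP phi)) e8.
have sm := small (\sum_(0 <= i < N) rnorm (phi (basis i))) _ e4.
change (\forall k \near \oo, rnorm (adjoint (S k) phi - adjoint T phi) < e).
near=> k; have Nk : (N <= k)%N by near: k; exists N.
apply: (@le_lt_trans _ _ (e / 2)); last by lra.
apply: rnorm_bop_le; first by lra.
move=> f; have -> : (adjoint (S k) phi - adjoint T phi) f =
    phi (S k f - T f - cut N (S k f - T f)) + phi (cut N (S k f - T f)).
  by rewrite -raddfD subrK raddfB.
apply: le_trans (ler_rnormD _ _) _.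
have h1 : rnorm (phi (cut N (S k f - T f))) <= e / 4 * rnorm f.
  rewrite (linear_cut _ _ (bounded_linear_linear (bopP phi))).
  apply: le_trans (ler_rnorm_sum _ _ _) _.
  apply: (@le_trans _ _ (2 ^- k * (\sum_(0 <= i < N) rnorm (phi (basis i))) * rnorm f)).
    rewrite mulr_sumr mulr_suml !big_nat; apply: ler_sum => i /andP[_ iN].
    rewrite rnormZ mulrAC ler_wpM2r ?rnorm_ge0 //.
    exact: (ST k i (leq_trans iN Nk)).1.
  by rewrite ler_wpM2r ?rnorm_ge0 //; near: k.
have h2 := hN (S k f - T f).
have h3 := D2 k f.
have : e / 8 * rnorm (S k f - T f) <= e / 8 * (2 * rnorm f) by rewrite ler_wpM2l // ltW.
lra.
Unshelve. all: by end_near.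
Qed.

(** Otherwise one could choose, for every [k], an operator outside [O] in the
    ball of index [k], and this sequence would converge to [T]. *)
Lemma SOTstar_nbhs_close T (O : set bH) : P1 T -> nbhs (T : SOTstar H H) O ->
  exists k, forall S, P1 S -> close k (2 ^- k) S T -> O S.
Proof.
move=> T1 TO; apply: contrapT => /forallNP no.
have ex k : exists S, [/\ P1 S, close k (2 ^- k) S T & ~ O S].
  apply: contrapT => /forallNP h; apply: (no k) => S S1 cS.
  by apply: contrapT => nO; exact: (h S).
have [S hS] := choice ex.
have : S @ \oo --> (T : SOTstar H H).
  by apply: close_SOTstar => // k; have [] := hS k.
move=> /(_ O TO) [k _ /(_ k (leqnn k))] OS.
by have [_ _] := hS k.
Qed.

End PositiveContractions.

(** * Baire category for positive contractions *)

Section Baire.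
Context {R : realType}.
Notation C := R[i].
Notation H := (ell2 R).
Notation bH := (bop H H).

Lemma ge0_limit (v : C) :
  (forall e : R, 0 < e -> exists2 u : C, 0 <= u & rnorm (v - u) <= e) -> 0 <= v.
Proof.
move=> h; rewrite lecE /=.
have Im0 : `|complex.Im v| <= 0.
  apply: le_small0 => e /h[u]; rewrite lecE /= => /andP[/eqP u0 _].
  by apply: le_trans; apply: le_trans (ler_rnorm_Im _); rewrite raddfB /= u0 subr0.
have -> /= : complex.Im v == 0 by rewrite -normr_eq0 eq_le Im0 /=.
apply/ler_addgt0Pr => e /h[u]; rewrite lecE /= => /andP[_ u0].
move=> /(le_trans (ler_rnorm_Re _)); rewrite raddfB /= ler_norml => /andP[h1 _].
lra.
Qed.

(** Each coordinate [T_j f i] is a Cauchy sequence by closeness of the [i]-th rows,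
    and its limit is bounded by [rnorm f]; the columns of the limit are
    controlled by Fatou's lemma. *)
Lemma close_limit (T : nat -> bH) (k : nat -> nat) : (forall j, P1 (T j)) ->
  (forall j, (k j < k j.+1)%N) ->
  (forall j, close (k j).+1 (2 ^- (k j).+1) (T j.+1) (T j)) ->
  exists2 S, P1 S & forall j, close (k j) (2 ^- k j) S (T j).
Proof.
move=> T1 kS TS.
have k_mono j l : (j <= l)%N -> (k j <= k l)%N.
  elim: l => [|l IH]; first by rewrite leqn0 => /eqP ->.
  by rewrite leq_eqVlt => /orP[/eqP ->//|/IH h]; exact: leq_trans h (ltnW (kS l)).
have k_ge j : (j <= k j)%N by elim: j => // j IH; exact: leq_ltn_trans (kS j).
have Tjl j l : (j <= l)%N -> close (k j) (2 ^- k j - 2 ^- k l) (T l) (T j).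
  elim: l => [|l IH].
    rewrite leqn0 => /eqP -> i _; rewrite !subrr rnorm0.
    by split=> // f; rewrite subrr rnorm0 mul0r.
  rewrite leq_eqVlt => /orP[/eqP <-|].
    by move=> i _; rewrite !subrr rnorm0; split=> // f; rewrite subrr rnorm0 mul0r.
  rewrite ltnS => jl.
  have h : close (k j) (2 ^- (k l).+1) (T l.+1) (T l).
    by apply: closeW (TS l) => //; rewrite (leq_trans (k_mono _ _ jl)).
  apply: closeW (close_trans h (IH jl)) => //.
  have := half_pow_le (R := R) (kS l); have := half_powS (R := R) (k l); lra.
(* Before the [i]-th row is under control, contractivity gives the trivial rate. *)
pose c f i j := if (i < k j)%N then 2 ^- k j * rnorm (f : H) else 2 * rnorm f.
have c0 f i e : 0 < e -> exists L, forall j, (L <= j)%N -> c f i j <= e.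
  move=> e0; have [J hJ] := half_pow_small (rnorm f) e0.
  exists (maxn J i.+1) => j; rewrite geq_max => /andP[Jj ij].
  rewrite /c (leq_trans ij (k_ge j)); apply: le_trans hJ.
  by rewrite ler_wpM2r ?rnorm_ge0 // half_pow_le // (leq_trans Jj).
have lim (p : H * nat) : exists v : C, forall j, rnorm (v - T j p.1 p.2) <= c p.1 p.2 j.
  case: p => f i /=; apply: cauchy_limit => [j l jl|e e0]; last first.
    by have [L /(_ L (leqnn L)) h] := c0 f i e e0; exists L.
  rewrite /c; case: ifP => ik.
    have [/(_ f) h _] := Tjl j l jl i ik; apply: le_trans h _.
    by rewrite ler_wpM2r ?rnorm_ge0 // gerBl invr_ge0 exprn_ge0.
  rewrite -coordB; apply: le_trans (ler_rnorm_coord _ _) _.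
  apply: le_trans (ler_rnormD _ _) _; rewrite rnormN mulr_natl mulr2n.
  by apply: lerD; exact: P1_contraction.
have {lim}[t tP] := choice lim.
have tc f i e : 0 < e -> exists L, forall l, (L <= l)%N ->
    rnorm (t (f, i) - T l f i) <= e.
  move=> /(c0 f i)[L hL]; exists L => l /hL; exact: le_trans (tP (f, i) l).
have vec f : exists x : H, (forall i, x i = t (f, i)) /\ rnorm x <= rnorm f.
  have [|||x xt xn] := @ell2_fatou R (fun l => T l f) (fun i => t (f, i)) (rnorm f).
  - exact: rnorm_ge0.
  - by move=> l; exact: P1_contraction.
  - by move=> i e; exact: tc.
  - by exists x.
have {vec}[F FP] := choice vec.
have [|||S S1 SE] := @P1_make R F.
- move=> a x y; apply: ell2P => i; rewrite coordD coordZ !(proj1 (FP _)).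
  apply: (@limit_linear R H (fun l f => T l f i) (fun f => t (f, i))) => [l c0' u v|].
    by rewrite bop_linear.
  by move=> f e; exact: tc.
- by move=> x; have [] := FP x.
- move=> x x0 i; rewrite (proj1 (FP _)); apply: ge0_limit => e e0.
  have [L /(_ L (leqnn L)) h] := tc x i e e0; exists (T L x i) => //.
  by have [Tp _] := T1 L; exact: Tp.
exists S => // j i ik; split=> [f|].
  rewrite SE (proj1 (FP _)); have := tP (f, i) j; by rewrite /c ik.
rewrite SE.
have [|||x xE xn] := @ell2_fatou R (fun l => T (maxn j l) (basis i) - T j (basis i))
   (F (basis i) - T j (basis i)) (2 ^- k j).
- by rewrite invr_ge0 exprn_ge0.
- move=> l; have [_ h] := Tjl j _ (leq_maxl j l) i ik; apply: le_trans h _.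
  by rewrite gerBl invr_ge0 exprn_ge0.
- move=> m e /(tc (basis i) m)[L hL]; exists L => l Ll.
  rewrite !coordB (proj1 (FP _)) opprB addrA subrK.
  exact: hL (leq_trans Ll (leq_maxr _ _)).
by rewrite -(ell2P xE).
Qed.

(** The Baire category theorem for [SOT^*] on the positive contractions, with the
    balls [close k (2 ^- k)] as basic neighbourhoods.  The step from index [k] to
    [k.+1] leaves room for the sum of all later steps. *)
Lemma baire_P1 (W : nat -> set bH) :
  (forall n S, P1 S -> W n S ->
    exists k, forall S', P1 S' -> close k (2 ^- k) S' S -> W n S') ->
  (forall n T k, P1 T -> exists S, [/\ P1 S, close k (2 ^- k) S T & W n S]) ->
  forall T k, P1 T ->
    exists S, [/\ P1 S, close k (2 ^- k) S T & forall n, W n S].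
Proof.
move=> Wo Wd T k T1.
have step (q : nat * (bH * nat)) : exists p' : bH * nat, P1 q.2.1 ->
   [/\ P1 p'.1, (q.2.2 < p'.2)%N, close q.2.2.+1 (2 ^- q.2.2.+1) p'.1 q.2.1 &
     forall S, P1 S -> close p'.2 (2 ^- p'.2) S p'.1 -> W q.1 S].
  case: q => n [U m] /=; have [U1|nU] := pselect (P1 U); last by exists (U, m).
  have [S [S1 SU WS]] := Wd n U m.+1 U1.
  have [l hl] := Wo n S S1 WS.
  exists (S, maxn m.+1 l) => _; split=> //=; first exact: leq_maxl.
  move=> S' S'1 cS; apply: hl => //; apply: closeW cS; first exact: leq_maxr.
  exact/half_pow_le/leq_maxr.
have {step}[g gP] := choice step.
pose s := fix s n : bH * nat := if n is m.+1 then g (m, s m) else (T, k).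
have s1 n : P1 (s n).1 by elim: n => // n IH /=; have [] := gP (n, s n) IH.
have [|||S S1 cS] := @close_limit (fun n => (s n).1) (fun n => (s n).2).
- exact: s1.
- by move=> n; have [] := gP (n, s n) (s1 n).
- by move=> n; have [] := gP (n, s n) (s1 n).
exists S; split=> //; first exact: cS 0%N.
by move=> n; have [_ _ _] := gP (n, s n) (s1 n); apply=> //; exact: (cS n.+1).
Qed.

End Baire.

(** * Isometric dilation of a strict contraction matrix *)

Section FiniteDim.
Context {R : realType}.
Local Open Scope sesquilinear_scope.
Notation C := R[i].
Context {N : nat}.
Implicit Types (f g p q : 'cV[C]_N) (b D : 'M[C]_N).

Definition dot f g : C := \sum_(i < N) f i 0 * (g i 0)^*%C.
Definition sqnorm f : R := \sum_(i < N) rnorm (f i 0) ^+ 2.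

Lemma dotE f g : dot f g = (g^t* *m f) 0 0.
Proof. by rewrite !mxE; apply: eq_bigr => i _; rewrite !mxE mulrC. Qed.

Lemma dot_sqnorm f : dot f f = (sqnorm f)%:C.
Proof. by rewrite /sqnorm rmorph_sum; apply: eq_bigr => i _; rewrite mulr_conj. Qed.

Lemma sqnorm_ge0 f : 0 <= sqnorm f.
Proof. by apply: sumr_ge0 => i _; exact: sqr_ge0. Qed.

Lemma sqnormZ (a : C) f : sqnorm (a *: f) = rnorm a ^+ 2 * sqnorm f.
Proof.
by rewrite /sqnorm mulr_sumr; apply: eq_bigr => i _; rewrite mxE rnormM exprMn.
Qed.

Lemma sqnorm0 : sqnorm 0 = 0.
Proof. by rewrite /sqnorm big1 // => i _; rewrite mxE rnorm0 expr0n. Qed.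

Lemma dotZl (a : C) f g : dot (a *: f) g = a * dot f g.
Proof. by rewrite /dot mulr_sumr; apply: eq_bigr => i _; rewrite mxE mulrA. Qed.

Lemma dotZr (a : C) f g : dot f (a *: g) = a^*%C * dot f g.
Proof.
rewrite /dot mulr_sumr; apply: eq_bigr => i _; rewrite mxE.
by rewrite (rmorphM (@conjc _ : {rmorphism _ -> _})) mulrCA.
Qed.

Lemma dot0l g : dot 0 g = 0.
Proof. by rewrite /dot big1 // => i _; rewrite mxE mul0r. Qed.

Lemma dot_le f g : rnorm (dot f g) ^+ 2 <= sqnorm f * sqnorm g.
Proof.
apply: (@le_trans _ _ ((\sum_(i < N) rnorm (f i 0) * rnorm (g i 0)) ^+ 2)).
  rewrite ler_pXn2r ?nnegrE ?rnorm_ge0 ?sumr_ge0 // => [|i _]; last first.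
    by rewrite mulr_ge0 ?rnorm_ge0.
  apply: le_trans (ler_rnorm_sum _ _ _) _; apply: ler_sum => i _.
  by rewrite rnormM rnorm_conj.
by apply: cauchy_schwarz_sum => i; exact: rnorm_ge0.
Qed.

(** The defect operator of the contraction [b]: the matrix [1 - b^* b] is
    positive semidefinite, hence of the form [D^* D] by the spectral theorem. *)
Lemma contraction_defect b : (forall f, sqnorm (b *m f) <= sqnorm f) ->
  exists D, forall f g, dot (D *m f) (D *m g) = dot f g - dot (b *m f) (b *m g).
Proof.
move=> bc.
pose G : 'M[C]_N := 1%:M - b^t* *m b.
have GE f g : (g^t* *m G *m f) 0 0 = dot f g - dot (b *m f) (b *m g).
  rewrite !dotE.
  transitivity ((g^t* *m f - (b *m g)^t* *m (b *m f)) 0 0); last first.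
    by rewrite mxE [X in _ + X]mxE.
  congr (fun_of_matrix _ 0 0).
  by rewrite /G mulmxBr mulmxBl mulmx1 trmx_mul map_mxM !mulmxA.
have Gh : G^t* = G.
  rewrite /G linearB /= map_mxB trmx1 map_mx1; congr (_ - _).
  by rewrite trmx_mul map_mxM trmxCK.
have Gn : G \is normalmx by apply/normalmxP; rewrite Gh.
have [P [d [PP GS]]] : exists (P : 'M[C]_N) (d : 'rV[C]_N),
    P *m P^t* = 1%:M /\ G = P^t* *m diag_mx d *m P.
  have Pu := spectral_unitarymx G.
  exists (spectralmx G), (spectral_diag G); split; first exact/unitarymxP.
  by rewrite -(invmx_unitary Pu); exact: (orthomx_spectralP Gn).
have d0 i : 0 <= d 0 i.
  pose e := delta_mx i (0 : 'I_1) : 'cV[C]_N.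
  have : dot (P^t* *m e) (P^t* *m e) - dot (b *m (P^t* *m e)) (b *m (P^t* *m e)) = d 0 i.
    rewrite -GE GS trmx_mul map_mxM trmxCK !mulmxA -[e^t* *m P *m _]mulmxA.
    rewrite PP mulmx1 -[_ *m P *m P^t* ]mulmxA PP.
    rewrite mulmx1 mxE (bigD1 i) //= big1 ?addr0 => [|j ji]; last first.
      by rewrite !mxE (negPf ji) /= mulr0.
    rewrite mul_mx_diag !mxE !eqxx mulr1 /=.
    by rewrite conjC1 mul1r.
  by move=> <-; rewrite !dot_sqnorm -rmorphB /= ler0c subr_ge0.
exists (diag_mx (\row_i sqrtC (d 0 i)) *m P) => f g.
rewrite -GE dotE GS.
clear GS GE Gn Gh G.
congr (fun_of_matrix _ 0 0).
set S := diag_mx (\row_i _).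
have SS : S^t* *m S = diag_mx d.
  apply/matrixP => i j; rewrite tr_diag_mx map_diag_mx mul_diag_mx !mxE.
  case: eqP => [->|_]; last by rewrite !mulr0n mulr0.
  rewrite !mulr1n -[RHS]sqrtCK expr2; congr (_ * _).
  have /CrealP : sqrtC (d 0 j) \is Num.real by rewrite ger0_real // sqrtC_ge0.
  exact.
have -> : (S *m P *m g)^t* = g^t* *m P^t* *m S^t*.
  by rewrite trmx_mul map_mxM trmx_mul map_mxM; exact: mulmxA.
by rewrite !mulmxA -[_ *m S^t* *m S]mulmxA SS.
Qed.

Lemma sqnorm_iter b (r : R) f n : 0 <= r -> (forall f, sqnorm (b *m f) <= r * sqnorm f) ->
  sqnorm (iter n (mulmx b) f) <= r ^+ n * sqnorm f.
Proof.
move=> r0 br; elim: n => [|n IH]; first by rewrite expr0 mul1r.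
by rewrite iterS exprS -mulrA; apply: le_trans (br _) _; rewrite ler_wpM2l.
Qed.

(** For [b^K -> 0] this says that [f |-> (D b^k f)_k] is isometric; it intertwines
    [b] with the backward shift. *)
Lemma defect_telescope b D f g K :
  (forall f g, dot (D *m f) (D *m g) = dot f g - dot (b *m f) (b *m g)) ->
  \sum_(0 <= k < K) dot (D *m iter k (mulmx b) f) (D *m iter k (mulmx b) g) =
  dot f g - dot (iter K (mulmx b) f) (iter K (mulmx b) g).
Proof.
move=> bD; elim: K => [|K IH]; first by rewrite big_geq // subrr.
by rewrite big_nat_recr //= IH bD addrA subrK.
Qed.

End FiniteDim.

Lemma sum_window (V : zmodType) (F : nat -> V) (M J : nat) :
  \sum_(0 <= j < (M + J).+1) (if (M <= j < M + J)%N then F (j - M)%N else 0) =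
  \sum_(0 <= k < J) F k.
Proof.
rewrite (big_cat_nat (n := M)) //=; last by rewrite -addnS leq_addr.
rewrite big_nat big1 ?add0r => [|j /andP[_ jM]]; last by rewrite leqNgt jM.
rewrite -{1}(add0n M) big_addn subSn ?leq_addr // addKn big_nat_recr //=.
rewrite leq_addl [(J + M)%N]addnC ltnn addr0.
apply: eq_big_nat => j /andP[_ jJ]; by rewrite leq_addl addnC ltn_add2l jJ addKn.
Qed.

Section Correction.
Context {R : realType}.
Notation C := R[i].

(** A level of the shift consists of [N] dilation channels, with entries [g],
    followed by one correction channel, with entry [a]. *)
Definition snoc_entry N (g : 'cV[C]_N) (a : C) (l : nat) : C :=
  if insub l is Some i then g i 0 else a.

Lemma snoc_entry0 N l : snoc_entry (0 : 'cV[C]_N) 0 l = 0.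
Proof. by rewrite /snoc_entry; case: insubP => // i _ _; rewrite mxE. Qed.

Lemma sum_snoc_entry (V : zmodType) N (g h : 'cV[C]_N) (a c : C) (F : C -> C -> V) :
  \sum_(0 <= l < N.+1) F (snoc_entry g a l) (snoc_entry h c l) =
  \sum_(i < N) F (g i 0) (h i 0) + F a c.
Proof.
rewrite big_nat_recr //= big_mkord; congr (_ + _).
  by apply: eq_bigr => i _; rewrite /snoc_entry valK.
by rewrite /snoc_entry insubN // ltnn.
Qed.

(** [U] and [V] describe two vectors by levels [j] and channels [l]; the backward
    shift acts by [U j l |-> U j.+1 l].  In the first [N] channels [U] is the
    dilated orbit of [b^M x], delayed by [M] levels, and [V] the dilated orbit of
    [q]; the pairing is then [- <b^n x, q>] for [n >= M], up to a truncation
    error whose square is of order [r^J].  The last channel of [U] contains, at level [n < M],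
    whatever is missing.  The scaling by [t] balances the norms of [U] and [V]. *)
Lemma dilation_correction (N M : nat) (b : 'M[C]_N) (x q : 'cV[C]_N) (t r e : R) :
  0 < t -> 0 <= r -> r < 1 -> (forall f, sqnorm (b *m f) <= r * sqnorm f) ->
  (forall n, (0 < n < M)%N -> rnorm (dot (iter n (mulmx b) x) q) <= t ^+ 2) ->
  sqnorm (iter M (mulmx b) x) <= t ^+ 4 -> 0 < e ->
  exists (U V : nat -> nat -> C) (L : nat),
  [/\ forall j l, (L <= j)%N -> U j l = 0 /\ V j l = 0,
     \sum_(0 <= j < L) \sum_(0 <= l < N.+1) rnorm (U j l) ^+ 2 <=
       t ^+ 2 * (4 * M.+1%:R * (1 + sqnorm q) ^+ 2),
     \sum_(0 <= j < L) \sum_(0 <= l < N.+1) rnorm (V j l) ^+ 2 <=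
       t ^+ 2 * (4 * M.+1%:R * (1 + sqnorm q) ^+ 2) &
     forall n, (0 < n)%N ->
       rnorm (dot (iter n (mulmx b) x) q +
         \sum_(0 <= j < L) \sum_(0 <= l < N.+1) V j l * U (j + n)%N l) <= e].
Proof.
move=> t0 r0 r1 br cx pM e0.
have bc f : sqnorm (b *m f) <= sqnorm f.
  by apply: le_trans (br f) _; rewrite ler_piMl ?sqnorm_ge0 // ltW.
have [D DP] := contraction_defect bc.
set p := iter M (mulmx b) x in pM.
(* The dilated orbits are cut off after [J] levels. *)
have [J JP] : exists J, r ^+ J * (sqnorm p * sqnorm q) <= e ^+ 2.
  by apply: geometric_small; rewrite ?exprn_gt0.
pose g k := D *m iter k (mulmx b) p.
pose h k := D *m iter k (mulmx b) q.
pose Uv j := if (M <= j < M + J)%N then (t^-1)%:C *: g (j - M)%N else 0.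
pose Vv j := if (j < J)%N then (- t)%:C *: h j else 0.
pose L := (M + J).+1.
pose s n := \sum_(0 <= j < L) dot (Uv (j + n)%N) (Vv j).
pose al n : C :=
  if (0 < n < M)%N then - (dot (iter n (mulmx b) x) q + s n) / t%:C else 0.
pose be (j : nat) : C := if j == 0%N then t%:C else 0.
have beC j : (be j)^*%C = be j by rewrite /be; case: eqP; rewrite ?conjc0 ?conjc_real.
have UvE j : sqnorm (Uv j) =
    if (M <= j < M + J)%N then t ^- 2 * sqnorm (g (j - M)%N) else 0.
  rewrite /Uv; case: ifP => _; last exact: sqnorm0.
  by rewrite sqnormZ rnorm_real real_normK ?num_real // exprVn.
have telN z : \sum_(0 <= k < J) sqnorm (D *m iter k (mulmx b) z) <= sqnorm z.
  have := defect_telescope z z J DP.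
  under eq_bigr do rewrite dot_sqnorm; rewrite -rmorph_sum /= !dot_sqnorm -rmorphB /=.
  by move/complexI => ->; rewrite gerBl sqnorm_ge0.
have UvN : \sum_(0 <= j < L) sqnorm (Uv j) <= t ^+ 2.
  under eq_bigr do rewrite UvE.
  rewrite (sum_window (fun k => t ^- 2 * sqnorm (g k))) -mulr_sumr.
  rewrite ler_pdivrMl ?exprn_gt0 // -exprD.
  by apply: le_trans pM; exact: telN.
have VvN : \sum_(0 <= j < L) sqnorm (Vv j) <= t ^+ 2 * sqnorm q.
  rewrite (big_cat_nat (n := J)) //=; last by rewrite /L ltnW // ltnS leq_addl.
  rewrite [X in _ + X]big_nat [X in _ + X]big1 ?addr0 => [|j /andP[jJ _]]; last first.
    by rewrite /Vv ltnNge jJ /= sqnorm0.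
  rewrite big_nat (eq_bigr (fun j => t ^+ 2 * sqnorm (h j))); last first.
    by move=> j /andP[_ jJ]; rewrite /Vv jJ sqnormZ rnorm_real real_normK ?num_real // sqrrN.
  by rewrite -big_nat -mulr_sumr ler_wpM2l ?sqr_ge0 //; exact: telN.
have q0 := sqnorm_ge0 q.
have dot_am f k : rnorm (@dot R N f k) <= (sqnorm f + sqnorm k) / 2.
  rewrite -(@ler_pXn2r _ 2) // ?nnegrE ?rnorm_ge0 ?divr_ge0 ?addr_ge0 ?sqnorm_ge0 //.
  apply: le_trans (dot_le _ _) _.
  have := sqr_ge0 (sqnorm f - sqnorm k); nra.
have t2 : 0 < t ^+ 2 by rewrite exprn_gt0.
have UvN' n : \sum_(0 <= j < L) sqnorm (Uv (j + n)%N) <= t ^+ 2.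
  apply: le_trans UvN.
  have := big_addn 0 (L + n) n xpredT (fun j => sqnorm (Uv j)).
  rewrite addnK add0n => <-.
  apply: (@le_trans _ _ (\sum_(0 <= j < L + n) sqnorm (Uv j))).
    rewrite [leRHS](big_cat_nat (n := n)) //= ?leq_addl // lerDr.
    by apply: sumr_ge0 => j _; exact: sqnorm_ge0.
  rewrite (big_cat_nat (n := L)) //= ?leq_addr // gerDl big_nat.
  apply: sumr_le0 => j /andP[Lj _]; rewrite UvE [(j < _)%N]ltnNge.
  by rewrite (_ : (M + J <= j)%N) ?andbF // ltnW.
have sN n : rnorm (s n) <= t ^+ 2 * (1 + sqnorm q) / 2.
  apply: le_trans (ler_rnorm_sum _ _ _) _.
  apply: (@le_trans _ _ (\sum_(0 <= j < L) (sqnorm (Uv (j + n)%N) + sqnorm (Vv j)) / 2)).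
    by apply: ler_sum => j _; exact: dot_am.
  rewrite -mulr_suml big_split /= ler_wpM2r //.
  by rewrite mulrDr mulr1 lerD.
have alN n : rnorm (al n) ^+ 2 <= t ^+ 2 * (4 * (1 + sqnorm q) ^+ 2).
  rewrite /al; case: ifP => [nM|_]; last first.
    by rewrite rnorm0 expr0n /= mulr_ge0 ?sqr_ge0 // mulr_ge0 ?sqr_ge0.
  have : rnorm (- (dot (iter n (mulmx b) x) q + s n) / t%:C) <= t * (2 * (1 + sqnorm q)).
    rewrite rnormM rnormV rnorm_real gtr0_norm // rnormN ler_pdivrMr //.
    apply: le_trans (ler_rnormD _ _) _.
    have := cx n nM; have := sN n.
    nra.
  move=> hh; have -> : t ^+ 2 * (4 * (1 + sqnorm q) ^+ 2) = (t * (2 * (1 + sqnorm q))) ^+ 2.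
    by ring.
  by rewrite ler_pXn2r ?nnegrE ?rnorm_ge0 //; rewrite !mulr_ge0 ?addr_ge0 // ltW.
have pairE n : \sum_(0 <= j < L) \sum_(0 <= l < N.+1)
   (snoc_entry (Vv j) (be j) l)^*%C * snoc_entry (Uv (j + n)%N) (al (j + n)%N) l =
   s n + t%:C * al n.
  rewrite (eq_bigr (fun j => dot (Uv (j + n)%N) (Vv j) +
      (be j)^*%C * al (j + n)%N)); last first.
    move=> j _; rewrite (sum_snoc_entry _ _ _ _ (fun z w => z^*%C * w)).
    by congr (_ + _); apply: eq_bigr => i _; rewrite mulrC.
  rewrite big_split /=; congr (_ + _).
  under eq_bigr do rewrite beC.
  by rewrite /L big_nat_recl // add0n big1 ?addr0 // => j _; rewrite mul0r.
exists (fun j => snoc_entry (Uv j) (al j)).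
exists (fun j l => ((snoc_entry (Vv j) (be j) l)^*)%C).
exists L; split.
- move=> j l jL.
  have jMJ : (j < M + J)%N = false by apply/negbTE; rewrite -leqNgt; exact: ltnW.
  have jM : (j < M)%N = false.
    by apply/negbTE; rewrite -leqNgt (leq_trans _ (ltnW jL)) // leq_addr.
  have jJ : (j < J)%N = false.
    by apply/negbTE; rewrite -leqNgt (leq_trans _ (ltnW jL)) // leq_addl.
  rewrite /Uv /Vv /al /be jMJ jM jJ !andbF (gtn_eqF (leq_ltn_trans (leq0n _) jL)).
  by rewrite snoc_entry0 conjc0.
- rewrite (eq_bigr (fun j => sqnorm (Uv j) + rnorm (al j) ^+ 2)); last first.
    by move=> j _; rewrite (sum_snoc_entry _ (Uv j) _ (al j) (fun z w => rnorm z ^+ 2)).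
  rewrite big_split /=.
  have al_sum : \sum_(0 <= j < L) rnorm (al j) ^+ 2 <=
      M%:R * (t ^+ 2 * (4 * (1 + sqnorm q) ^+ 2)).
    rewrite (big_cat_nat (n := M)) //=; last by rewrite /L ltnW // ltnS leq_addr.
    rewrite [X in _ + X]big_nat [X in _ + X]big1 ?addr0 => [|j /andP[jM _]]; last first.
      by rewrite /al [(j < M)%N]ltnNge jM andbF rnorm0 expr0n.
    apply: le_trans (ler_sum _ (fun j _ => alN j)) _.
    by rewrite sumr_const_nat subn0 [leRHS]mulr_natl.
  apply: le_trans (lerD UvN al_sum) _.
  rewrite -[M.+1]addn1 natrD.
  have M0 : 0 <= M%:R :> R by [].
  move: (M%:R : R) M0 => m m0; nra.
- rewrite (eq_bigr (fun j => sqnorm (Vv j) + rnorm (be j) ^+ 2)); last first.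
    move=> j _; under eq_bigr do rewrite rnorm_conj.
    by rewrite (sum_snoc_entry _ (Vv j) _ (be j) (fun z w => rnorm z ^+ 2)).
  rewrite big_split /=.
  have -> : \sum_(0 <= j < L) rnorm (be j) ^+ 2 = t ^+ 2.
    rewrite /L big_nat_recl // big1 => [|j _]; last by rewrite rnorm0 expr0n.
    by rewrite /be /= rnorm_real real_normK ?num_real ?addr0.
  apply: le_trans (_ : t ^+ 2 * sqnorm q + t ^+ 2 <= _); first by rewrite lerD2r.
  have M1 : 1 <= M.+1%:R :> R by rewrite ler1n.
  move: (M.+1%:R : R) M1 => m m0.
  have -> : t ^+ 2 * sqnorm q + t ^+ 2 = t ^+ 2 * (1 + sqnorm q) by ring.
  rewrite ler_wpM2l ?sqr_ge0 // -mulrA.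
  have S1 : 1 + sqnorm q <= (1 + sqnorm q) ^+ 2 by nra.
  move: ((1 + sqnorm q) ^+ 2) S1 => S S1; nra.
move=> n n0; rewrite pairE.
have [nM|Mn] := ltnP n M.
  rewrite /al n0 nM /= mulrC divfK; last by rewrite eq_complex /= eqxx andbT gt_eqF.
  by rewrite addrA subrr rnorm0 ltW.
rewrite /al [(_ < M)%N]ltnNge Mn andbF mulr0 addr0.
pose k := (n - M)%N; have nE : n = (k + M)%N by rewrite subnK.
have xk : iter n (mulmx b) x = iter k (mulmx b) p by rewrite nE iterD.
have -> : s n = - (dot (iter k (mulmx b) p) q -
    dot (iter (J - k + k) (mulmx b) p) (iter (J - k) (mulmx b) q)).
  rewrite iterD -(defect_telescope _ _ _ DP) -sumrN /s.
  rewrite (big_cat_nat (n := (J - k)%N)) //=; last first.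
    by rewrite (leq_trans (leq_subr _ _)) // /L ltnW // ltnS leq_addl.
  rewrite [X in _ + X]big_nat [X in _ + X]big1 ?addr0 => [|j /andP[jk _]]; last first.
    rewrite /Uv [(_ < M + J)%N]ltnNge (_ : (M + J <= j + n)%N) ?andbF ?dot0l //.
    by clear -jk nE; lia.
  apply: eq_big_nat => j /andP[_ jk].
  rewrite /Uv /Vv (_ : (M <= j + n < M + J)%N); last by clear -jk nE; lia.
  rewrite (_ : (j < J)%N); last by clear -jk; lia.
  have -> : (j + n - M)%N = (j + k)%N by clear -nE; lia.
  rewrite dotZl dotZr /g /h -iterD.
  rewrite conjc_real mulrA -rmorphM mulrN mulVf ?gt_eqF //.
  by rewrite rmorphN rmorph1 mulN1r.
rewrite xk opprB addrC subrK.
rewrite -(@ler_pXn2r _ 2) // ?nnegrE ?rnorm_ge0 ?(ltW e0) //.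
apply: le_trans JP; apply: le_trans (dot_le _ _) _.
have := sqnorm_iter p (J - k + k) r0 br.
have := sqnorm_iter q (J - k) r0 br.
have rJ : r ^+ (J - k + k) <= r ^+ J by rewrite ler_wiXn2l ?(ltW r1) //; clear; lia.
have rk : r ^+ (J - k) <= 1 by rewrite exprn_ile1 // ltW.
have := sqnorm_ge0 p; have := sqnorm_ge0 (iter (J - k) (mulmx b) q).
have := sqnorm_ge0 (iter (J - k + k) (mulmx b) p).
move: (sqnorm (iter _ _ p)) (sqnorm (iter _ _ q)) => P Q P0 Q0 p0 Qle Ple.
rewrite mulrA; apply: ler_pM => //.
  by apply: le_trans Ple _; rewrite ler_wpM2r.
by apply: le_trans Qle _; rewrite ler_piMl.
Qed.

End Correction.

(** * Truncation plus shift *)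

Section Block.
Context {R : realType}.
Notation C := R[i].
Notation H := (ell2 R).
Notation bH := (bop H H).
Implicit Types (T S : bH) (f x y : H).

(** The orthogonality of the two blocks, in the domain as well as in the range,
    makes this a contraction; positivity is clear as the entries of [T] and of a
    shift are nonnegative. *)
Lemma block_operator T N (r : R) : P1 T -> 0 <= r -> r <= 1 ->
  exists S, [/\ P1 S,
    forall f i, S f i =
      r%:C * (if (i < N)%N then r%:C * T (cut N f) i else f (i + N.+1)%N) &
    forall f, rnorm (S f) <= r * rnorm f].
Proof.
move=> T1 r0 r1.
pose h f i : C := if (i < N)%N then r%:C * T (cut N f) i else f (i + N.+1)%N.
have hn f n : \sum_(0 <= i < n) rnorm (h f i) ^+ 2 <= rnorm f ^+ 2.
  apply: (@le_trans _ _ (\sum_(0 <= i < n + N) rnorm (h f i) ^+ 2)).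
    rewrite [leRHS](big_cat_nat (n := n)) ?leq_addr //= lerDl sumr_ge0 // => j _.
    exact: sqr_ge0.
  rewrite (big_cat_nat (n := N)) ?leq_addl //.
  apply: le_trans (ell2_sqr_sum_le f (n + N + N.+1)).
  rewrite [leRHS](big_cat_nat (n := N)) //=; last by lia.
  apply: lerD.
    apply: (@le_trans _ _ (\sum_(0 <= i < N) rnorm (T (cut N f) i) ^+ 2)).
      rewrite !big_nat; apply: ler_sum => i /andP[_ iN]; rewrite /h iN.
      rewrite ler_pXn2r ?nnegrE ?rnorm_ge0 // rnormM rnorm_real ger0_norm //.
      by rewrite ler_piMl ?rnorm_ge0.
    apply: le_trans (ell2_sqr_sum_le _ _) _; rewrite -sqr_rnorm_cut.
    by rewrite ler_pXn2r ?nnegrE ?rnorm_ge0 //; exact: P1_contraction.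
  rewrite [leRHS](big_cat_nat (n := (N + N.+1)%N)) //=; [|by lia|by lia].
  rewrite -[leLHS]add0r lerD ?sumr_ge0 // => [i _|]; first exact: sqr_ge0.
  rewrite big_addn addnK big_nat [leRHS]big_nat ler_sum // => i /andP[Ni _].
  by rewrite /h ltnNge Ni.
have vec f : exists x : H, (forall i, x i = r%:C * h f i) /\ rnorm x <= r * rnorm f.
  have [||x xE xn] := @ell2_make R (fun i => r%:C * h f i) (r * rnorm f).
  - by rewrite mulr_ge0 ?rnorm_ge0.
  - move=> n; rewrite exprMn.
    under eq_bigr do rewrite rnormM rnorm_real ger0_norm // exprMn.
    by rewrite -mulr_sumr ler_wpM2l ?sqr_ge0.
  by exists x.
have {vec}[F FP] := choice vec.
have [|||S S1 SE] := @P1_make R F.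
- move=> a x y; apply: ell2P => i; rewrite coordD coordZ !(proj1 (FP _)) /h.
  case: ifP => _; last by rewrite coordD coordZ; ring.
  have -> : cut N (a *: x + y : H) = a *: cut N x + cut N y.
    by apply: ell2P => j; rewrite coordD coordZ !cutE; case: ifP => //; rewrite mulr0 addr0.
  by rewrite bop_linear coordD coordZ; ring.
- by move=> x; apply: le_trans (proj2 (FP x)) _; rewrite ler_piMl ?rnorm_ge0.
- move=> x x0 i; rewrite (proj1 (FP _)) /h mulr_ge0 ?ler0c //.
  case: ifP => _ //; rewrite mulr_ge0 ?ler0c //.
  by have [Tp _] := T1; apply: Tp => j; rewrite cutE; case: ifP.
exists S; split=> // [f i|f]; rewrite SE; last exact: (proj2 (FP f)).
exact: (proj1 (FP f)).
Qed.

Definition to_col N (f : nat -> C) : 'cV[C]_N := \col_(i < N) f i.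
Definition of_col N (g : 'cV[C]_N) : nat -> C := snoc_entry g 0.

Definition block_matrix T N (r : R) : 'M[C]_N :=
  \matrix_(i < N, j < N) (r%:C * T (basis j) i).

Lemma of_col_ord N (g : 'cV[C]_N) (i : 'I_N) : of_col g i = g i 0.
Proof. by rewrite /of_col /snoc_entry valK. Qed.

Lemma of_colE N (g : 'cV[C]_N) i (iN : (i < N)%N) : of_col g i = g (Ordinal iN) 0.
Proof. exact: (of_col_ord g (Ordinal iN)). Qed.

Lemma to_colE N (f : nat -> C) i : (i < N)%N -> of_col (to_col N f) i = f i.
Proof. by move=> iN; rewrite of_colE mxE. Qed.

Lemma sqnorm_cut N (g : 'cV[C]_N) : sqnorm g = rnorm (cut N (of_col g)) ^+ 2.
Proof.
by rewrite sqr_rnorm_cut big_mkord; apply: eq_bigr => i _; rewrite of_col_ord.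
Qed.

Lemma block_matrix_mul T N r (g : 'cV[C]_N) i : (i < N)%N ->
  of_col (block_matrix T N r *m g) i = r%:C * T (cut N (of_col g)) i.
Proof.
move=> iN; rewrite of_colE mxE (linear_cut _ _ (bop_linear T)) coord_sum.
rewrite mulr_sumr big_mkord; apply: eq_bigr => j _.
by rewrite mxE coordZ of_col_ord /= -mulrA; congr (_ * _); rewrite mulrC.
Qed.

Lemma block_matrix_sqnorm T N r (g : 'cV[C]_N) : P1 T -> 0 <= r ->
  sqnorm (block_matrix T N r *m g) <= r ^+ 2 * sqnorm g.
Proof.
move=> T1 r0; rewrite !sqnorm_cut sqr_rnorm_cut.
under eq_big_nat => i /andP[_ iN] do
  rewrite block_matrix_mul // rnormM rnorm_real ger0_norm // exprMn.
rewrite -mulr_sumr ler_wpM2l ?sqr_ge0 //.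
apply: le_trans (ell2_sqr_sum_le _ _) _.
by rewrite ler_pXn2r ?nnegrE ?rnorm_ge0 //; exact: P1_contraction.
Qed.

(** The two blocks do not interact, so powers are computed in each block. *)
Lemma block_iter T S N r n f i :
  (forall f i, S f i =
      r%:C * (if (i < N)%N then r%:C * T (cut N f) i else f (i + N.+1)%N)) ->
  iter n S f i = r%:C ^+ n *
    (if (i < N)%N then of_col (iter n (mulmx (block_matrix T N r)) (to_col N f)) i
     else f (i + n * N.+1)%N).
Proof.
move=> SE; elim: n i => [|n IH] i.
  by rewrite expr0 mul1r mul0n addn0; case: ifP => // iN; rewrite to_colE.
rewrite iterS SE exprS -mulrA; congr (_ * _).
case: ifP => iN; last first.
  rewrite IH [(_ < N)%N]ltnNge (_ : (N <= i + N.+1)%N) /=; last by lia.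
  by rewrite mulSn addnA.
rewrite iterS block_matrix_mul //.
set g := iter n (mulmx _) _.
have -> : cut N (iter n S f) = r%:C ^+ n *: cut N (of_col g).
  by rewrite -cutZ; apply: eq_cut => j jN; rewrite IH jN.
by rewrite linearZ coordZ mulrCA.
Qed.

Lemma compress_iter T N r n f i : (forall i, (N <= i)%N -> f i = 0) ->
  iter n (fun g : H => r%:C *: cut N (T (cut N g))) f i =
  of_col (iter n (mulmx (block_matrix T N r)) (to_col N f)) i.
Proof.
move=> f0.
have cutK (g : 'cV[C]_N) : forall i, (N <= i)%N -> of_col g i = 0.
  by move=> j Nj; rewrite /of_col /snoc_entry insubN // -leqNgt.
elim: n i => [|n IH] i.
  case: (ltnP i N) => iN; first by rewrite to_colE.
  by rewrite cutK //; exact: f0.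
rewrite iterS coordZ cutE; case: (ltnP i N) => iN; last by rewrite mulr0 cutK.
rewrite iterS block_matrix_mul //; congr (_ * T _ _).
by apply: eq_cut => j _; exact: IH.
Qed.

End Block.

Section Approximation.
Context {R : realType}.
Notation C := R[i].
Notation H := (ell2 R).
Notation bH := (bop H H).
Implicit Types (T S : bH) (f x y : H).

(** The scaling factor is tied to the truncation length so that a single
    parameter governs the approximation. *)
Definition shrink (N : nat) : R := 1 - N.+2%:R^-1.

Lemma shrink_itv N : 0 < shrink N < 1.
Proof.
rewrite /shrink subr_gt0 gtrBl invr_gt0 ltr0n andbT invf_lt1 ?ltr0n //.
by rewrite ltr1n.
Qed.

Lemma subr1C (r : R) : (1 - r)%:C = 1 - r%:C.
Proof. by rewrite rmorphB rmorph1. Qed.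

Lemma shrink_near e : 0 < e -> exists N, forall n, (N <= n)%N -> 1 - shrink n <= e.
Proof.
move=> e0; have [N _ hN] := near_infty_natSinv_lt (PosNum e0).
exists N => n Nn; rewrite /shrink opprB addrC subrK.
apply: le_trans (ltW (hN n Nn)) => /=.
by rewrite lef_pV2 ?posrE ?ltr0n // ler_nat.
Qed.

Lemma compress_near T x e : P1 T -> 0 < e -> exists N, forall n, (N <= n)%N ->
  rnorm ((shrink n)%:C *: cut n (T (cut n x)) - T x) <= e.
Proof.
move=> T1 e0.
have e3 : 0 < e / 3 by rewrite divr_gt0.
have e3x : 0 < e / (3 * (1 + rnorm x)).
  by rewrite divr_gt0 // mulr_gt0 // ltr_pwDl ?rnorm_ge0.
have [N1 h1] := cut_approx x e3; have [N2 h2] := cut_approx (T x) e3.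
have [N3 h3] := shrink_near e3x.
exists (maxn N1 (maxn N2 N3)) => n; rewrite !geq_max => /and3P[n1 n2 n3].
have {}h1 := h1 n n1; have {}h2 := h2 n n2; have {}h3 := h3 n n3.
have /andP[r0 r1] := shrink_itv n.
have -> : (shrink n)%:C *: cut n (T (cut n x)) - T x =
   - ((1 - shrink n)%:C *: cut n (T (cut n x))) - cut n (T (x - cut n x))
   - (T x - cut n (T x)).
  rewrite (linearBf _ _ (bop_linear T)).
  apply: ell2P => i; rewrite !(coordB, coordN, coordZ, cutE).
  by case: ifP => _; rewrite subr1C; ring.
apply: le_trans (ler_rnormD _ _) _; rewrite rnormN.
apply: le_trans (lerD (ler_rnormD _ _) h2) _; rewrite !rnormN.
have k1 : rnorm (cut n (T (x - cut n x))) <= e / 3.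
  apply: le_trans (ler_rnorm_cut _ _) _; apply: le_trans h1.
  exact: P1_contraction.
have k2 : rnorm ((1 - shrink n)%:C *: cut n (T (cut n x))) <= e / 3.
  rewrite rnormZ rnorm_real ger0_norm ?subr_ge0 ?(ltW r1) //.
  have k3 : rnorm (cut n (T (cut n x))) <= 1 + rnorm x.
    apply: le_trans (ler_rnorm_cut _ _) _; apply: le_trans (P1_contraction T1 _) _.
    by apply: le_trans (ler_rnorm_cut _ _) _; rewrite lerDr.
  apply: le_trans (ler_pM _ _ h3 k3) _; rewrite ?rnorm_ge0 ?subr_ge0 ?(ltW r1) //.
  rewrite invfM mulrA divfK // gt_eqF // ltr_pwDl ?rnorm_ge0 //.
lra.
Qed.

Lemma compress_contraction T n x : P1 T ->
  rnorm ((shrink n)%:C *: cut n (T (cut n x))) <= rnorm x.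
Proof.
move=> T1; have /andP[r0 r1] := shrink_itv n.
rewrite rnormZ rnorm_real ger0_norm ?(ltW r0) //.
apply: (@le_trans _ _ (rnorm (cut n (T (cut n x))))).
  by rewrite ler_piMl ?rnorm_ge0 ?(ltW r1).
apply: le_trans (ler_rnorm_cut _ _) _; apply: le_trans (P1_contraction T1 _) _.
exact: ler_rnorm_cut.
Qed.

Lemma compress_iter_near T x M e : P1 T -> 0 < e ->
  exists N, forall n, (N <= n)%N -> forall m, (m <= M)%N ->
  rnorm (iter m (fun g : H => (shrink n)%:C *: cut n (T (cut n g))) x - iter m T x) <= e.
Proof.
move=> T1; elim: M e => [|M IH] e e0.
  by exists 0%N => n _ m; rewrite leqn0 => /eqP ->; rewrite subrr rnorm0 ltW.
have e2 : 0 < e / 2 by rewrite divr_gt0.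
have [N1 h1] := IH _ e2; have [N2 h2] := compress_near (iter M T x) T1 e2.
exists (maxn N1 N2) => n; rewrite geq_max => /andP[n1 n2] m.
have {}h1 := h1 n n1; have {}h2 := h2 n n2.
rewrite leq_eqVlt => /orP[/eqP ->|]; last first.
  by rewrite ltnS => /h1; move=> /le_trans; apply; lra.
rewrite !iterS.
set B := fun g : H => _; set u := iter M B x; set w := iter M T x.
have -> : B u - T w = B (u - w) + (B w - T w).
  rewrite addrA; congr (_ - _); apply: ell2P => i.
  rewrite /B !(coordB, coordD, coordZ, cutE).
  have -> : cut n (u - w : H) = cut n u - cut n w.
    by apply: ell2P => j; rewrite !(coordB, cutE); case: ifP; rewrite ?subrr.
  by rewrite (linearBf _ _ (bop_linear T)) coordB; case: ifP => _; ring.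
apply: le_trans (ler_rnormD _ _) _.
have := compress_contraction n (u - w) T1; rewrite -/(B _).
have := h1 M (leqnn M); rewrite -/u -/w; move: h2; rewrite -/(B _) -/w; lra.
Qed.

(** For [n >= k] the shift does not occur in the first [k] rows and columns, so
    this reduces to the convergence of the truncations. *)
Lemma block_close T k (e : R) : P1 T -> 0 < e -> exists N, forall n, (N <= n)%N ->
  forall S, (forall f i, S f i = (shrink n)%:C *
      (if (i < n)%N then (shrink n)%:C * T (cut n f) i else f (i + n.+1)%N)) ->
  close k e S T.
Proof.
move=> T1 e0.
have e3 : 0 < e / 3 by rewrite divr_gt0.
have [N0 h0] := shrink_near e3.
have col : exists N, forall n, (N <= n)%N -> forall i, (i < k)%N ->
    rnorm ((shrink n)%:C *: cut n (T (cut n (basis i))) - T (basis i)) <= e / 3.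
  elim: k => [|k [N hN]]; first by exists 0%N.
  have [N' hN'] := compress_near (basis k) T1 e3.
  exists (maxn N N') => n; rewrite geq_max => /andP[Nn N'n] i.
  by rewrite ltnS leq_eqVlt => /orP[/eqP ->|]; [exact: hN'|exact: hN].
have row : exists N, forall n, (N <= n)%N -> forall i, (i < k)%N ->
    forall f : H, rnorm (T (f - cut n f) i) <= e / 3 * rnorm f.
  elim: k {col} => [|k [N hN]]; first by exists 0%N.
  have [||||N' hN'] := @functional_tail R (fun f => T f k) 1 (e / 3).
  - by move=> a u v; rewrite bop_linear.
  - by [].
  - move=> u; rewrite mul1r; apply: le_trans (ler_rnorm_coord _ _) _.
    exact: P1_contraction.
  - exact: e3.
  exists (maxn N N') => n; rewrite geq_max => /andP[Nn N'n] i.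
  by rewrite ltnS leq_eqVlt => /orP[/eqP ->|]; [exact: hN'|exact: hN].
have [N1 h1] := col; have [N2 h2] := row.
exists (maxn k (maxn N0 (maxn N1 N2))) => n.
rewrite !geq_max => /and4P[kn n0 n1 n2] S SE i ik.
have /andP[r0 r1] := shrink_itv n.
have {}h0 := h0 n n0; have {}h1 := h1 n n1 i ik; have {}h2 := h2 n n2 i ik.
have in_ : (i < n)%N := leq_trans ik kn.
have sq : 1 - shrink n ^+ 2 <= 2 * (e / 3) by nra.
have sq0 : 0 <= 1 - shrink n ^+ 2 by nra.
split=> [f|].
  rewrite SE in_.
  have -> : (shrink n)%:C * ((shrink n)%:C * T (cut n f) i) - T f i =
      - ((1 - shrink n ^+ 2)%:C * T (cut n f) i) - T (f - cut n f) i.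
    by rewrite (linearBf _ _ (bop_linear T)) coordB subr1C rmorphXn /=; ring.
  apply: le_trans (ler_rnormD _ _) _; rewrite !rnormN rnormM rnorm_real ger0_norm //.
  have a1 : rnorm (T (cut n f) i) <= rnorm f.
    apply: le_trans (ler_rnorm_coord _ _) _.
    by apply: le_trans (P1_contraction T1 _) _; exact: ler_rnorm_cut.
  have a2 := ler_pM sq0 (rnorm_ge0 _) sq a1.
  have := h2 f; lra.
have -> : S (basis i) = (shrink n)%:C *: ((shrink n)%:C *: cut n (T (cut n (basis i)))).
  apply: ell2P => j; rewrite SE !coordZ cutE; case: ltnP => // nj.
  by rewrite basisE gtn_eqF ?mulr0 //; lia.
set z := _ *: cut _ _ in h1 *.
have -> : (shrink n)%:C *: z - T (basis i) = - ((1 - shrink n)%:C *: z) + (z - T (basis i)).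
  by rewrite subr1C scalerBl scale1r opprB addrA subrK.
apply: le_trans (ler_rnormD _ _) _; rewrite rnormN rnormZ rnorm_real.
rewrite ger0_norm ?subr_ge0 ?(ltW r1) //.
have z1 : rnorm z <= 1 by rewrite -(rnorm_basis i); exact: compress_contraction.
have r01 : 0 <= 1 - shrink n by rewrite subr_ge0 ltW.
have := ler_pM r01 (rnorm_ge0 _) h0 z1; lra.
Qed.

End Approximation.

Section TailVectors.
Context {R : realType}.
Notation C := R[i].
Notation H := (ell2 R).
Notation bH := (bop H H).
Implicit Types (T S : bH) (f x y : H).

Lemma sum_tail (V : zmodType) (F : nat -> V) N m L :
  \sum_(N <= i < N + L * m) F i =
  \sum_(0 <= j < L) \sum_(0 <= l < m) F (N + (j * m + l))%N.
Proof.
elim: L => [|L IH]; first by rewrite mul0n addn0 !big_geq.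
rewrite big_nat_recr //= -IH (big_cat_nat (n := (N + L * m)%N)) //=; last 2 first.
- by rewrite leq_addr.
- by rewrite leq_add2l leq_mul2r leqnSn orbT.
congr (_ + _); rewrite -{1}[(N + L * m)%N]add0n big_addn.
have -> : (N + L.+1 * m - (N + L * m) = m)%N by rewrite mulSn; lia.
by apply: eq_bigr => l _; rewrite addnC addnA.
Qed.

(** The coordinates from [N] on are read as levels of [N + 1] channels, so that the
    shift by [N + 1] coordinates lowers the level by one. *)
Definition tail_vector N L (U : nat -> nat -> C) : H :=
  cut (N + L * N.+1) (fun i =>
    if (N <= i)%N then U ((i - N) %/ N.+1)%N ((i - N) %% N.+1)%N else 0).

Lemma tail_vector_low N L U i : (i < N)%N -> tail_vector N L U i = 0.
Proof. by move=> iN; rewrite cutE [(N <= i)%N]leqNgt iN /=; case: ifP. Qed.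

Lemma tail_vectorE N L U j l : (forall j l, (L <= j)%N -> U j l = 0) ->
  (l < N.+1)%N -> tail_vector N L U (N + (j * N.+1 + l))%N = U j l.
Proof.
move=> UL lN; rewrite cutE leq_addr addKn divnMDl // divn_small // addn0.
rewrite modnMDl modn_small // ltn_add2l.
have [jL|Lj] := ltnP j L; last by rewrite UL // if_same.
rewrite (_ : (_ < L * N.+1)%N) // (@leq_trans (j.+1 * N.+1)) //.
  by rewrite mulSn addnC ltn_add2r.
by rewrite leq_mul2r jL orbT.
Qed.

Lemma sqr_rnorm_tail N L U : (forall j l, (L <= j)%N -> U j l = 0) ->
  rnorm (tail_vector N L U) ^+ 2 =
  \sum_(0 <= j < L) \sum_(0 <= l < N.+1) rnorm (U j l) ^+ 2.
Proof.
move=> UL; rewrite sqr_rnorm_cut (big_cat_nat (n := N)) ?leq_addr //=.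
rewrite [X in X + _]big_nat [X in X + _]big1 ?add0r => [|i /andP[_ iN]]; last first.
  by rewrite leqNgt iN /= rnorm0 expr0n.
rewrite sum_tail; apply: eq_bigr => j _; rewrite !big_nat.
apply: eq_bigr => l /andP[_ lN].
rewrite leq_addr addKn divnMDl // divn_small // addn0.
by rewrite modnMDl modn_small.
Qed.

(** [dilation_correction] realized in [ell2]: [u] and [v] live on the coordinates
    of the shift and [x], [y] on those of the compression, so the pairing of the
    orbit splits into the pairing in each block.  The common factor [r ^+ n] only
    helps. *)
Lemma tail_correction T S N r x y M t e : P1 T -> 0 < r -> r < 1 ->
  (forall f i, S f i =
      r%:C * (if (i < N)%N then r%:C * T (cut N f) i else f (i + N.+1)%N)) ->
  (forall i, (N <= i)%N -> x i = 0) -> (forall i, (N <= i)%N -> y i = 0) ->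
  0 < t ->
  (forall n, (0 < n < M)%N ->
    rnorm (pair N y (iter n (fun g : H => r%:C *: cut N (T (cut N g))) x)) <= t ^+ 2) ->
  rnorm (iter M (fun g : H => r%:C *: cut N (T (cut N g))) x) <= t ^+ 2 ->
  0 < e ->
  exists (u v : H) (K : nat), [/\
    rnorm u ^+ 2 <= t ^+ 2 * (4 * M.+1%:R * (1 + rnorm y ^+ 2) ^+ 2),
    rnorm v ^+ 2 <= t ^+ 2 * (4 * M.+1%:R * (1 + rnorm y ^+ 2) ^+ 2),
    (N <= K)%N /\ (forall i, (K <= i)%N -> u i = 0 /\ v i = 0) &
    forall n, (0 < n)%N -> rnorm (pair K (y + v : H) (iter n S (x + u))) <= e].
Proof.
move=> T1 r0 r1 SE x0 y0 t0 cx xM e0.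
set B := fun g : H => _ in cx xM.
pose b := block_matrix T N r.
pose q := to_col N (fun i => (y i)^*%C) : 'cV[C]_N.
pose xc := to_col N x : 'cV[C]_N.
have BE n i : iter n B x i = of_col (iter n (mulmx b) xc) i.
  exact: compress_iter.
have dotP (g : 'cV[C]_N) : dot g q = pair N y (of_col g).
  rewrite /pair big_mkord; apply: eq_bigr => i _.
  by rewrite of_col_ord mxE conjcK mulrC.
have qN : sqnorm q = rnorm y ^+ 2.
  rewrite sqnorm_cut sqr_rnorm_cut.
  have -> : y = cut N y.
    by apply: ell2P => i; rewrite cutE; case: ltnP => // /y0.
  rewrite sqr_rnorm_cut; apply: eq_big_nat => i /andP[_ iN].
  by rewrite /q to_colE // rnorm_conj.
have [|||||||U [V [L [UV0 UN VN UVe]]]] := @dilation_correction R N M b xc q t (r ^+ 2) e.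
- exact: t0.
- by rewrite sqr_ge0.
- by rewrite exprn_ilt1 ?(ltW r0).
- by move=> f; apply: block_matrix_sqnorm => //; exact: ltW.
- move=> n nM; rewrite dotP; have := cx n nM.
  by congr (rnorm _ <= _); apply: eq_bigr => i _; rewrite BE.
- rewrite sqnorm_cut (_ : t ^+ 4 = (t ^+ 2) ^+ 2); last by rewrite -exprM.
  rewrite ler_pXn2r ?nnegrE ?rnorm_ge0 ?sqr_ge0 //; apply: le_trans xM.
  rewrite -(eq_cut (f := iter M B x)) ?ler_rnorm_cut // => i _; exact: BE.
- exact: e0.
have U0 j l : (L <= j)%N -> U j l = 0 by move=> /(UV0 j l)[].
have V0 j l : (L <= j)%N -> V j l = 0 by move=> /(UV0 j l)[].
exists (tail_vector N L U), (tail_vector N L V), (N + L * N.+1)%N.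
rewrite (sqr_rnorm_tail N U0) (sqr_rnorm_tail N V0) -qN.
split; [exact: UN|exact: VN| |].
  split; first exact: leq_addr.
  by move=> i Ki; rewrite !cutE ltnNge Ki.
move=> n n0.
set u := tail_vector N L U; set v := tail_vector N L V.
have -> : pair (N + L * N.+1) (y + v : H) (iter n S (x + u)) =
   r%:C ^+ n * (dot (iter n (mulmx b) xc) q +
     \sum_(0 <= j < L) \sum_(0 <= l < N.+1) V j l * U (j + n)%N l).
  rewrite /pair (big_cat_nat (n := N)) ?leq_addr // sum_tail mulrDr.
  congr (_ + _).
    rewrite dotP /pair mulr_sumr; apply: eq_big_nat => i /andP[_ iN].
    rewrite coordD tail_vector_low // addr0 (block_iter _ _ _ SE) iN mulrCA.
    have -> // : to_col N (x + u : H) = xc.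
    by apply/matrixP => k l; rewrite !mxE coordD tail_vector_low // addr0.
  rewrite mulr_sumr; apply: eq_bigr => j _.
  rewrite mulr_sumr; apply: eq_big_nat => l /andP[_ lN].
  rewrite coordD y0 ?leq_addr // add0r tail_vectorE //.
  rewrite (block_iter _ _ _ SE) (_ : (N + _ < N)%N = false); last first.
    by apply/negbTE; rewrite -leqNgt leq_addr.
  rewrite coordD x0; last by lia.
  have -> : (N + (j * N.+1 + l) + n * N.+1 = N + ((j + n) * N.+1 + l))%N by lia.
  by rewrite add0r tail_vectorE // mulrCA.
rewrite rnormM -rmorphXn rnorm_real ger0_norm ?exprn_ge0 ?(ltW r0) //.
apply: le_trans (UVe n n0); rewrite ler_piMl ?rnorm_ge0 //.
by rewrite exprn_ile1 ?(ltW r0) ?(ltW r1).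
Qed.

End TailVectors.

(** * Density of the inductive step *)

Section InductiveStep.
Context {R : realType}.
Notation C := R[i].
Notation H := (ell2 R).
Notation bH := (bop H H).
Implicit Types (T S : bH) (f x y : H) (a b : seq (rat * rat)).

(** Gaussian rational vectors of finite support: a countable dense set. *)
Definition rat_vec a : H := cut (size a)
  (fun i => (ratr (nth (0, 0) a i).1 : R) +i* (ratr (nth (0, 0) a i).2 : R)).

Lemma rat_complex_dense (z : C) (e : R) : 0 < e ->
  exists q : rat * rat, rnorm (((ratr q.1 : R) +i* (ratr q.2 : R)) - z) <= e.
Proof.
move=> e0; have e2 : 0 < e / 2 by rewrite divr_gt0.
have real (s : R) : exists q : rat, `|ratr q - s| <= e / 2.
  have [|q] := @rat_in_itvoo R s (s + e / 2); first by rewrite ltrDl.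
  rewrite in_itv /= => /andP[q1 q2]; exists q.
  rewrite ger0_norm ?subr_ge0 ?(ltW q1) //; lra.
have [q1 h1] := real (complex.Re z); have [q2 h2] := real (complex.Im z).
exists (q1, q2); apply: le_trans (rnorm_le_ReIm _) _; rewrite !raddfB /=; lra.
Qed.

Lemma rat_vec_dense K (f : nat -> C) (e : R) : 0 < e ->
  exists2 a, size a = K & rnorm (rat_vec a - cut K f) <= e.
Proof.
move=> e0; have eK : 0 < e / K.+1%:R by rewrite divr_gt0.
have [q qP] := choice (fun i => rat_complex_dense (f i) eK).
exists (mkseq q K); first exact: size_mkseq.
have -> : rat_vec (mkseq q K) - cut K f =
    cut K (fun i => ((ratr (q i).1 : R) +i* (ratr (q i).2 : R)) - f i).
  apply: ell2P => i; rewrite coordB !cutE size_mkseq; case: ltnP => iK.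
    by rewrite nth_mkseq.
  by rewrite subrr.
apply: le_trans (rnorm_cut_le_sum _ _) _.
apply: (@le_trans _ _ (\sum_(0 <= i < K) e / K.+1%:R)); first exact: ler_sum.
rewrite sumr_const_nat subn0 -[_ *+ K]mulr_natr -mulrA ler_piMr ?(ltW e0) //.
by rewrite mulrC ler_pdivrMr // mul1r ler_nat.
Qed.

Lemma rat_vec_basis N : exists a, rat_vec a = basis N.
Proof.
exists (mkseq (fun i => ((i == N)%:R, 0)) N.+1); apply: ell2P => i.
rewrite cutE basisE size_mkseq; case: ltnP => iN; last by rewrite gtn_eqF.
by rewrite nth_mkseq //= rmorph0 ratr_nat; case: eqP.
Qed.

Lemma rat_vec_support a i : (size a <= i)%N -> rat_vec a i = 0.
Proof. by move=> ai; rewrite cutE ltnNge ai. Qed.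

(** With the error [tolerance ^+ 2], the norms of the corrections produced by
    [tail_correction] are at most [2 ^- k] ([tolerance_bound]). *)
Definition tolerance (k M : nat) b : R :=
  2 ^- k / (4 * M.+1%:R * (1 + rnorm (rat_vec b) ^+ 2)).

Lemma tolerance_den_gt0 M (s : R) : 0 < 4 * M.+1%:R * (1 + s ^+ 2).
Proof. by rewrite !mulr_gt0 // ltr_pwDl ?sqr_ge0. Qed.

Lemma tolerance_gt0 k M b : 0 < tolerance k M b.
Proof. by rewrite divr_gt0 ?tolerance_den_gt0 // invr_gt0 exprn_gt0. Qed.

Lemma tolerance_bound k M b :
  tolerance k M b ^+ 2 * (4 * M.+1%:R * (1 + rnorm (rat_vec b) ^+ 2) ^+ 2) <= (2 ^- k) ^+ 2.
Proof.
have d0 := tolerance_den_gt0 M (rnorm (rat_vec b)).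
have E : tolerance k M b * (4 * M.+1%:R * (1 + rnorm (rat_vec b) ^+ 2)) = 2 ^- k.
  by rewrite divfK // gt_eqF.
move: (tolerance k M b) E => th <-; rewrite exprMn ler_wpM2l ?sqr_ge0 //.
rewrite exprMn ler_wpM2r ?sqr_ge0 //.
have : 1 <= M.+1%:R :> R by rewrite ler1n.
by move: (M.+1%:R : R) => m m1; nra.
Qed.

Definition vec_pair b f : C := pair (size b) (rat_vec b) f.

(** The hypotheses of a correction step, up to a factor [2] which leaves room for
    a perturbation of [T]. *)
Definition admissible k M a b T :=
  (forall n, (0 < n < M)%N -> rnorm (vec_pair b (iter n T (rat_vec a))) < tolerance k M b ^+ 2 / 2) /\
  rnorm (iter M T (rat_vec a)) < tolerance k M b ^+ 2 / 2.

(** An open condition which implies the failure of [admissible]: the case of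
    equality is left to the correction step. *)
Definition inadmissible k M a b T :=
  (exists2 n, (0 < n < M)%N & tolerance k M b ^+ 2 / 2 < rnorm (vec_pair b (iter n T (rat_vec a)))) \/
  tolerance k M b ^+ 2 / 2 < rnorm (iter M T (rat_vec a)).

Definition improvable k M a b T := inadmissible k M a b T \/
  exists M' a' b', [/\ admissible k.+1 M' a' b' T,
    rnorm (rat_vec a' - rat_vec a) <= 2 * 2 ^- k & rnorm (rat_vec b' - rat_vec b) <= 2 * 2 ^- k].

(** The bound [2 * 2 ^- k] on the steps, summed from [k = 3] on, is [1 / 2]; so the
    limits of both sequences stay away from [0]. *)
Definition started T := exists M a b N,
  [/\ admissible 3 M a b T, rat_vec a = basis N & rat_vec b = basis N].

Lemma iter_linearB T n x y : iter n T (x - y) = iter n T x - iter n T y.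
Proof. by elim: n => //= n ->; exact: (linearBf _ _ (bop_linear T)). Qed.

Lemma closexx k d T : 0 <= d -> close k d T T.
Proof.
by move=> d0 i _; rewrite subrr rnorm0; split=> // f; rewrite subrr rnorm0 mulr_ge0 ?rnorm_ge0.
Qed.

(** The first coordinate outside the compression is annihilated by the shift. *)
Lemma started_dense T k : P1 T ->
  exists S, [/\ P1 S, close k (2 ^- k) S T & started S].
Proof.
move=> T1; have [N /(_ N (leqnn N)) hN] := block_close k T1 (half_pow_gt0 k).
have /andP[r0 r1] := shrink_itv (R := R) N.
have [S [S1 SE _]] := block_operator N T1 (ltW r0) (ltW r1).
exists S; split=> //; first exact: hN.
have [a aN] := rat_vec_basis N; exists 1%N, a, a, N; split=> //; split.
  by move=> [|[|n]].
have -> : iter 1 S (rat_vec a) = 0.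
  rewrite aN /=; apply: ell2P => i; rewrite SE coord0; case: ifP => iN.
    have -> : cut N (basis N) = 0 :> H.
      by apply: ell2P => j; rewrite cutE basisE; case: ltnP => // jN; rewrite ltn_eqF.
    by rewrite linear0 coord0 !mulr0.
  by rewrite basisE gtn_eqF ?mulr0 //; lia.
by rewrite rnorm0 divr_gt0 // exprn_gt0 // tolerance_gt0.
Qed.

Lemma block_decay S (r : R) n x : 0 <= r -> (forall f, rnorm (S f) <= r * rnorm f) ->
  rnorm (iter n S x) <= r ^+ n * rnorm x.
Proof.
move=> r0 Sr; elim: n => [|n IH]; first by rewrite expr0 mul1r.
by rewrite iterS exprS -mulrA; apply: le_trans (Sr _) _; rewrite ler_wpM2l.
Qed.

(** Either [T] itself is inadmissible, or a block operator near [T] and the vectors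
    of [tail_correction] do what is needed: the norm of the [M']-th power of this
    operator is at most [r ^+ M'], which beats the square of the tolerance, of
    order [M' ^- 2]. *)
Lemma improvable_dense k M a b T m : P1 T ->
  exists S, [/\ P1 S, close m (2 ^- m) S T & improvable k M a b S].
Proof.
move=> T1; have [Tbad|Tnb] := pselect (inadmissible k M a b T).
  by exists T; split=> //; [apply: closexx; exact/ltW/half_pow_gt0|left].
set t := tolerance k M b; have t0 : 0 < t := tolerance_gt0 k M b.
set x := rat_vec a; set y := rat_vec b.
have y0 := rnorm_ge0 y; have x0 := rnorm_ge0 x.
have t20 : 0 < t ^+ 2 / 2 by rewrite divr_gt0 // exprn_gt0.
have hn n : (0 < n < M)%N -> rnorm (vec_pair b (iter n T x)) <= t ^+ 2 / 2.
  by move=> nM; rewrite leNgt; apply/negP => h; apply: Tnb; left; exists n.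
have hM : rnorm (iter M T x) <= t ^+ 2 / 2.
  by rewrite leNgt; apply/negP => h; apply: Tnb; right.
have eta0 : 0 < t ^+ 2 / 2 / (1 + rnorm y) by rewrite divr_gt0 // ltr_pwDl.
have [N1 h1] := compress_iter_near x M T1 eta0.
have [N2 h2] := block_close m T1 (half_pow_gt0 m).
pose N := maxn (maxn (size a) (size b)) (maxn N1 N2).
have Na : (size a <= N)%N by rewrite /N; lia.
have Nb : (size b <= N)%N by rewrite /N; lia.
have {}h1 := h1 N ltac:(rewrite /N; lia).
have {}h2 := h2 N ltac:(rewrite /N; lia).
have /andP[r0 r1] := shrink_itv (R := R) N; set r := shrink N in r0 r1 h1 h2.
have [S [S1 SE Sr]] := block_operator N T1 (ltW r0) (ltW r1).
exists S; split=> //; [exact: h2|right].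
set B := fun g : H => _ in h1.
have etay : t ^+ 2 / 2 / (1 + rnorm y) * (1 + rnorm y) = t ^+ 2 / 2.
  by rewrite divfK // gt_eqF // ltr_pwDl.
set eta := t ^+ 2 / 2 / (1 + rnorm y) in eta0 h1 etay.
have BM : rnorm (iter M B x) <= t ^+ 2.
  rewrite -[iter M B x](subrK (iter M T x)); apply: le_trans (ler_rnormD _ _) _.
  have := h1 M (leqnn M); have : eta <= t ^+ 2 / 2 by rewrite -etay ler_peMr ?(ltW eta0) // lerDl.
  lra.
have Bn n : (0 < n < M)%N -> rnorm (pair N y (iter n B x)) <= t ^+ 2.
  move=> nM; rewrite -[iter n B x](subrK (iter n T x)) pairDr.
  apply: le_trans (ler_rnormD _ _) _.
  have {}h1 := h1 n ltac:(by case/andP: nM => _ /ltnW).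
  have := hn n nM.
  rewrite /vec_pair -(pair_support _ Nb); last by move=> i; exact: rat_vec_support.
  have := pair_le N y (iter n B x - iter n T x).
  have := ler_wpM2l y0 h1; rewrite -/y.
  have : rnorm y * eta <= t ^+ 2 / 2.
    by rewrite -etay mulrC ler_wpM2l ?(ltW eta0) // lerDr.
  lra.
(* The bounds [X] and [Y] on the norms of the next vectors are known before these
   vectors, hence [M'] and the lower bound [d] of the next tolerance can be
   chosen first. *)
pose X := rnorm x + 2; pose Y := rnorm y + 2.
have X0 : 0 < X by rewrite ltr_wpDl.
have Y0 : 0 < Y by rewrite ltr_wpDl.
pose c : R := 2 ^- k.+1 / (4 * (1 + Y ^+ 2)).
have c0 : 0 < c.
  by rewrite divr_gt0 ?half_pow_gt0 // mulr_gt0 // ltr_pwDl ?sqr_ge0.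
have c20 : 0 < c ^+ 2 / 2 by rewrite divr_gt0 ?exprn_gt0.
have [M' hM'] := poly_geometric_small X (ltW r0) r1 c20.
pose d := c / M'.+1%:R.
have d0 : 0 < d by rewrite divr_gt0.
have dM : d * M'.+1%:R = c by rewrite divfK.
have rd : r ^+ M' * X < d ^+ 2 / 2.
  have M0 : 0 < M'.+1%:R ^+ 2 :> R by rewrite exprn_gt0.
  rewrite -(ltr_pM2r M0) [ltRHS]mulrAC -exprMn dM.
  by move: hM'; rewrite mulrAC.
have d20 : 0 < d ^+ 2 by rewrite exprn_gt0.
have d40 : 0 < d ^+ 2 / 4 by rewrite divr_gt0.
have k0 := half_pow_gt0 (R := R) k.
have k1 : 2 ^- k <= 1 :> R by rewrite invf_le1 ?exprn_gt0 // exprn_ege1 // ler1n.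
have [||u [v [K [uN vN [NK uv0] uvP]]]] :=
    tail_correction (x := x) (y := y) (M := M) T1 r0 r1 SE _ _ t0 Bn BM d40.
- by move=> i Ni; rewrite rat_vec_support // (leq_trans Na).
- by move=> i Ni; rewrite rat_vec_support // (leq_trans Nb).
have small w : rnorm w ^+ 2 <= t ^+ 2 * (4 * M.+1%:R * (1 + rnorm y ^+ 2) ^+ 2) ->
    rnorm (w : H) <= 2 ^- k.
  move=> /le_trans /(_ (tolerance_bound k M b)).
  by rewrite ler_pXn2r ?nnegrE ?rnorm_ge0 ?(ltW k0).
have {}uN := small _ uN; have {}vN := small _ vN.
pose e' := Num.min (2 ^- k) (d ^+ 2 / 8 / (X + Y)).
have e'0 : 0 < e' by rewrite lt_min k0 /= divr_gt0 ?divr_gt0 // addr_gt0.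
have e'k : e' <= 2 ^- k by rewrite ge_min lexx.
have e'XY : e' * (X + Y) <= d ^+ 2 / 8.
  have h : e' <= d ^+ 2 / 8 / (X + Y) by rewrite ge_min lexx orbT.
  by rewrite -(ler_pdivlMr _ _ (addr_gt0 X0 Y0)).
have [a' a'K a'P] := rat_vec_dense K (x + u : H) e'0.
have [b' b'K b'P] := rat_vec_dense K (y + v : H) e'0.
have cutK (w z : H) : (forall i, (N <= i)%N -> w i = 0) ->
    (forall i, (K <= i)%N -> z i = 0) -> cut K (w + z : H) = w + z.
  move=> w0 z0; apply: ell2P => i; rewrite cutE coordD; case: ltnP => // Ki.
  by rewrite w0 ?z0 ?addr0 // (leq_trans NK).
rewrite cutK in a'P; last first.
- by move=> i /uv0[].
- by move=> i Ni; rewrite rat_vec_support // (leq_trans Na).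
rewrite cutK in b'P; last first.
- by move=> i /uv0[].
- by move=> i Ni; rewrite rat_vec_support // (leq_trans Nb).
have a'x : rnorm (rat_vec a' - x) <= 2 * 2 ^- k.
  have -> : rat_vec a' - x = (rat_vec a' - (x + u)) + u by rewrite opprD addrA subrK.
  apply: le_trans (ler_rnormD _ _) _; rewrite mulr_natl mulr2n.
  by apply: lerD uN; exact: le_trans a'P e'k.
have b'y : rnorm (rat_vec b' - y) <= 2 * 2 ^- k.
  have -> : rat_vec b' - y = (rat_vec b' - (y + v)) + v by rewrite opprD addrA subrK.
  apply: le_trans (ler_rnormD _ _) _; rewrite mulr_natl mulr2n.
  by apply: lerD vN; exact: le_trans b'P e'k.
have a'X : rnorm (rat_vec a') <= X.
  rewrite -[rat_vec a'](subrK x) addrC; apply: le_trans (ler_rnormD _ _) _.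
  by rewrite lerD2l; apply: le_trans a'x _; rewrite ler_piMr.
have b'Y : rnorm (rat_vec b') <= Y.
  rewrite -[rat_vec b'](subrK y) addrC; apply: le_trans (ler_rnormD _ _) _.
  by rewrite lerD2l; apply: le_trans b'y _; rewrite ler_piMr.
have xuX : rnorm (x + u) <= X.
  apply: le_trans (ler_rnormD _ _) _; rewrite lerD2l.
  by apply: le_trans uN _; apply: le_trans k1 _; rewrite ler1n.
have dt : d <= tolerance k.+1 M' b'.
  have -> : d = 2 ^- k.+1 * (4 * (1 + Y ^+ 2) * M'.+1%:R)^-1.
    by rewrite /d /c [in RHS]invfM mulrA.
  rewrite /tolerance ler_pM2l ?half_pow_gt0 //.
  rewrite lef_pV2 ?posrE ?tolerance_den_gt0 ?mulr_gt0 ?ltr_pwDl ?sqr_ge0 //.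
  rewrite mulrAC ler_pM2r // ler_pM2l // lerD2l.
  by rewrite ler_pXn2r ?nnegrE ?rnorm_ge0 ?(ltW Y0).
have dt2 : d ^+ 2 <= tolerance k.+1 M' b' ^+ 2.
  by rewrite ler_pXn2r ?nnegrE ?(ltW d0) ?(ltW (tolerance_gt0 _ _ _)).
exists M', a', b'; split; [|exact: a'x|exact: b'y].
split; last first.
  apply: le_lt_trans (block_decay _ _ (ltW r0) Sr) _.
  apply: (@le_lt_trans _ _ (r ^+ M' * X)).
    by rewrite ler_wpM2l ?exprn_ge0 ?(ltW r0).
  by apply: lt_le_trans rd _; rewrite ler_pM2r ?invr_gt0.
move=> n /andP[n0 _]; rewrite /vec_pair b'K.
have -> : pair K (rat_vec b') (iter n S (rat_vec a')) =
   pair K (y + v : H) (iter n S (x + u)) +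
   pair K (rat_vec b' - (y + v) : H) (iter n S (x + u)) +
   pair K (rat_vec b') (iter n S (rat_vec a' - (x + u))).
  by rewrite iter_linearB pairBr pairBl; ring.
have p1 := uvP n n0.
have p2 : rnorm (pair K (rat_vec b' - (y + v) : H) (iter n S (x + u))) <= e' * X.
  apply: le_trans (pair_le _ _ _) _; apply: ler_pM; rewrite ?rnorm_ge0 //.
  exact: le_trans (P1_iter n S1 _) xuX.
have p3 : rnorm (pair K (rat_vec b') (iter n S (rat_vec a' - (x + u)))) <= e' * Y.
  apply: le_trans (pair_le _ _ _) _; rewrite mulrC.
  apply: ler_pM; rewrite ?rnorm_ge0 //; exact: le_trans (P1_iter n S1 _) a'P.
apply: le_lt_trans (ler_rnormD _ _) _.
apply: le_lt_trans (lerD (ler_rnormD _ _) (lexx _)) _.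
move: p1 p2 p3 e'XY dt2 d20; clear.
move: (rnorm _) (rnorm _) (rnorm _) (tolerance _ _ _ ^+ 2) => A B D t.
rewrite [e' * (X + Y)]mulrDr; move: (e' * X) (e' * Y) (d ^+ 2) => u1 u2 d2; clear; lra.
Qed.

End InductiveStep.

(** * From almost orthogonal orbits to invariant subspaces *)

Section Invariant.
Context {R : realType}.
Notation C := R[i].
Notation H := (ell2 R).
Notation bH := (bop H H).
Implicit Types (T S : bH).

Lemma kernel_closed (W : normedModType C) (psi : H -> W) (K : R) : linear psi ->
  0 <= K -> (forall f, rnorm (psi f) <= K * rnorm f) ->
  forall f, closure [set g | psi g = 0] f -> psi f = 0.
Proof.
move=> lp K0 pK f clf; apply: rnorm_small0 => e e0.
have e0' : 0 < e / (K + 1) by rewrite divr_gt0 // ltr_wpDl.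
have nb : \forall g \near nbhs f, rnorm (g - f) < e / (K + 1).
  exact: ((@cvg_rnormP R _ _ _ id f (nbhs_filter f)).1 cvg_id).
have [g [/= g0 /ltW gf]] := clf _ nb.
have -> : psi f = psi (f - g) by rewrite linearBf // g0 subr0.
apply: le_trans (pK _) _; rewrite rnormB_sym; apply: le_trans (ler_wpM2l K0 gf) _.
by rewrite mulrCA ler_piMr ?(ltW e0) // ler_pdivrMr ?ltr_wpDl // mul1r lerDl.
Qed.

Lemma linear0f (V W : lmodType C) (psi : V -> W) : linear psi -> psi 0 = 0.
Proof. by move=> lp; rewrite -(subrr 0) linearBf // subrr. Qed.

(** The vectors [f] with [phi (T^n f) = 0] for all [n >= 1] form a closed invariant
    subspace containing [x].  If it is everything, the range of [T] lies in the
    kernel of [phi], which is then invariant; it is neither zero, being a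
    hyperplane, nor everything. *)
Lemma orthogonal_orbit_invariant T (phi : H -> C^o) (K : R) (x : H) N :
  linear phi -> 0 <= K -> (forall f, rnorm (phi f) <= K * rnorm f) ->
  x != 0 -> phi (basis N) != 0 ->
  (forall n, (0 < n)%N -> phi (iter n T x) = 0) ->
  has_nontrivial_invariant_subspace T.
Proof.
move=> lp K0 pK x0 pN px.
have lT := bop_linear T.
have iterl n : linear (iter n T) by elim: n => [|n IH] a u v //=; rewrite IH lT.
pose Y := [set f : H | forall n, (0 < n)%N -> phi (iter n T f) = 0].
have [YT|YT] := pselect (Y = setT); last first.
  exists Y; split=> //.
  - split=> [n _|a u v Yu Yv n n0]; first by rewrite (linear0f (iterl n)) (linear0f lp).
    by rewrite iterl lp Yu ?Yv // scaler0 addr0.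
  - move=> f clf n n0.
    apply: (@kernel_closed _ (phi \o iter n T) (K * opnorm T ^+ n)) => [a u v||g|].
    + by rewrite /= iterl lp.
    + by rewrite mulr_ge0 ?exprn_ge0 ?(opnorm_ge0 (bopP T)).
    + rewrite -mulrA; apply: le_trans (pK _) _; rewrite ler_wpM2l //.
      by apply: block_decay; [exact: opnorm_ge0 (bopP T)|exact: le_opnorm (bopP T)].
    by apply: closure_subset clf => g /(_ n n0).
  - move=> Y0; have : Y x by [].
    by rewrite Y0 => /= x00; rewrite x00 eqxx in x0.
  - by move=> _ [f Yf <-] n n0; rewrite -iterSr; exact: Yf.
exists [set f : H | phi f = 0]; split.
- split=> [|a u v /= pu pv]; first exact: linear0f.
  by rewrite lp pu pv scaler0 addr0.
- by move=> f; exact: kernel_closed K0 pK f.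
- move=> h; pose z : H := phi (basis N.+1) *: basis N - phi (basis N) *: basis N.+1.
  have : [set f : H | phi f = 0] z.
    rewrite /= /z linearBf // -[_ *: basis N]addr0 lp (linear0f lp) addr0.
    rewrite -[_ *: basis N.+1]addr0 lp (linear0f lp) addr0.
    by rewrite [_ *: phi (basis N)]mulrC subrr.
  rewrite h /= => /(congr1 (fun w : H => w N.+1)).
  rewrite /z coordB !coordZ !basisE eqxx gtn_eqF // mulr0 mulr1 sub0r coord0.
  by move/eqP; rewrite oppr_eq0 (negPf pN).
- move=> h; have : [set f : H | phi f = 0] (basis N) by rewrite h.
  by move=> /= pN0; rewrite pN0 eqxx in pN.
- move=> _ [f _ <-] /=; have : Y f by rewrite YT.
  by move=> /(_ 1%N (ltn0Sn _)).
Qed.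

Lemma ell2_complete (a : nat -> H) (c : nat -> R) :
  (forall j l, (j <= l)%N -> rnorm (a l - a j) <= c j) ->
  (forall e, 0 < e -> exists L, forall j, (L <= j)%N -> c j <= e) ->
  exists x : H, forall j, rnorm (x - a j) <= c j.
Proof.
move=> ac c0.
have coordlim i : exists v : C, forall j, rnorm (v - a j i) <= c j.
  apply: cauchy_limit => [j l jl|e /c0[L /(_ L (leqnn L)) h]]; last by exists L.
  by rewrite -coordB; apply: le_trans (ler_rnorm_coord _ _) _; exact: ac.
have [g gP] := choice coordlim.
have diff j : exists2 z : H, (forall i, z i = g i - a j i) & rnorm z <= c j.
  apply: (@ell2_fatou R (fun l => a (maxn j l) - a j)).
  - by apply: le_trans (ac j j (leqnn j)); exact: rnorm_ge0.
  - by move=> l; apply: ac; exact: leq_maxl.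
  - move=> i e /c0[L hL]; exists L => l Ll; rewrite coordB opprB addrA subrK.
    by apply: le_trans (gP i _) _; apply: hL; rewrite (leq_trans Ll) // leq_maxr.
have [z0 z0E _] := diff 0%N.
exists (z0 + a 0%N) => j; have [z zE zc] := diff j.
have -> // : z0 + a 0%N - a j = z.
by apply: ell2P => i; rewrite coordB coordD z0E zE subrK.
Qed.

Lemma vec_pair_linear b : linear (vec_pair b : H -> C^o).
Proof. by move=> c f g; rewrite /vec_pair pairDr pairZr. Qed.

(** The steps of the construction are iterated with [T] fixed.  The vectors [x_k]
    converge in norm, and the functionals given by the [y_k] converge uniformly
    on bounded sets; at step [k] all the values [<T^n x_k, y_k>] with [n >= 1] are
    small, by the tolerance for [n < M_k] and by the size of [T^(M_k) x_k] for the
    others. *)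
Lemma improvable_invariant T : P1 T -> started T ->
  (forall k M a b, improvable k M a b T) -> has_nontrivial_invariant_subspace T.
Proof.
move=> T1 [M0 [a0 [b0 [N [good0 a0N b0N]]]]] cont.
have step (p : nat * (nat * seq (rat * rat) * seq (rat * rat))) :
    exists p' : nat * seq (rat * rat) * seq (rat * rat),
    let: (k, (M, a, b)) := p in let: (M', a', b') := p' in
    admissible k M a b T -> [/\ admissible k.+1 M' a' b' T,
      rnorm (rat_vec a' - rat_vec a : H) <= 2 * 2 ^- k &
      rnorm (rat_vec b' - rat_vec b : H) <= 2 * 2 ^- k].
  case: p => k [[M a] b]; have [[[n nM h]|h]|[M' [a' [b' h]]]] := cont k M a b.
  - exists (M, a, b) => -[/(_ n nM)]; rewrite ltNge => /negP []; exact: ltW.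
  - exists (M, a, b) => -[_]; rewrite ltNge => /negP []; exact: ltW.
  - by exists (M', a', b').
have [g gP] := choice step.
pose s := fix s k := if k is j.+1 then g (j + 3, s j)%N else (M0, a0, b0).
pose M k := (s k).1.1; pose a k := (s k).1.2; pose b k := (s k).2.
have sE k : s k = (M k, a k, b k) by rewrite /M /a /b; case: (s k) => [[]].
have sgood k : admissible (k + 3) (M k) (a k) (b k) T /\
   (rnorm (rat_vec (a k.+1) - rat_vec (a k) : H) <= 2 * 2 ^- (k + 3) /\
    rnorm (rat_vec (b k.+1) - rat_vec (b k) : H) <= 2 * 2 ^- (k + 3)).
  elim: k => [|k [IH _]].
    split=> //; have := gP (3%N, (M0, a0, b0)).
    rewrite -[g _]/(s 1%N) sE => /(_ good0)[_]; by [].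
  have := gP ((k + 3)%N, (M k, a k, b k)).
  rewrite -{1}(sE k) -[g _]/(s k.+1) sE => /(_ IH)[h _ _].
  split=> //; have := gP ((k.+1 + 3)%N, (M k.+1, a k.+1, b k.+1)).
  by rewrite -{1}(sE k.+1) -[g _]/(s k.+2) sE => /(_ h)[].
have a0E : rat_vec (a 0%N) = basis N :> H by exact: a0N.
have b0E : rat_vec (b 0%N) = basis N :> H by exact: b0N.
pose c j : R := 2 ^- j.+1.
have stepc k : 2 * 2 ^- (k + 3) = c k - c k.+1.
  by rewrite /c addn3; have := half_powS (R := R) k.+1; have := half_powS (R := R) k.+2; lra.
have c_ge0 j : 0 <= c j by exact/ltW/half_pow_gt0.
have tele (w : nat -> H) : (forall k, rnorm (w k.+1 - w k) <= 2 * 2 ^- (k + 3)) ->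
    forall j l, (j <= l)%N -> rnorm (w l - w j) <= c j - c l.
  move=> ww j; elim=> [|l IH].
    by rewrite leqn0 => /eqP ->; rewrite !subrr rnorm0.
  rewrite leq_eqVlt => /orP[/eqP <-|]; first by rewrite !subrr rnorm0.
  rewrite ltnS => /IH h; rewrite -[w l.+1](subrK (w l)) -addrA.
  apply: le_trans (ler_rnormD _ _) _; have := ww l; rewrite stepc; lra.
have tele' (w : nat -> H) : (forall k, rnorm (w k.+1 - w k) <= 2 * 2 ^- (k + 3)) ->
    forall j l, (j <= l)%N -> rnorm (w l - w j) <= c j.
  move=> ww j l jl; apply: le_trans (tele w ww j l jl) _; by rewrite gerBl.
have c0 e : 0 < e -> exists L, forall j, (L <= j)%N -> c j <= e.
  move=> /(half_pow_small 1)[L hL]; exists L => j Lj; rewrite mulr1 in hL.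
  by apply: le_trans hL; apply: half_pow_le; exact: leq_trans Lj (leqnSn j).
have acauchy := tele' (fun k => rat_vec (a k)) (fun k => (sgood k).2.1).
have bcauchy := tele' (fun k => rat_vec (b k)) (fun k => (sgood k).2.2).
have [x xa] := ell2_complete acauchy c0.
have prc j l f : (j <= l)%N -> rnorm (vec_pair (b l) f - vec_pair (b j) f) <= c j * rnorm f.
  move=> jl; pose K := maxn (size (b j)) (size (b l)).
  rewrite /vec_pair -(pair_support (K := K) _ (leq_maxr _ _)); last first.
    by move=> i; exact: rat_vec_support.
  rewrite -(pair_support (N := size (b j)) (K := K) _ (leq_maxl _ _)); last first.
    by move=> i; exact: rat_vec_support.
  rewrite -pairBl; apply: le_trans (pair_le _ _ _) _.
  by rewrite ler_wpM2r ?rnorm_ge0 // bcauchy.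
have cf0 f e : 0 < e -> exists L, forall j, (L <= j)%N -> c j * rnorm (f : H) <= e.
  move=> e0; have e0' : 0 < e / (1 + rnorm f) by rewrite divr_gt0 // ltr_pwDl ?rnorm_ge0.
  have [L hL] := c0 _ e0'; exists L => j /hL h.
  have f0 := rnorm_ge0 f.
  rewrite ler_pdivlMr ?ltr_pwDl // in h; apply: le_trans h.
  by rewrite ler_wpM2l // lerDr.
have phiex (f : H) : exists v : C^o, forall j, rnorm (v - vec_pair (b j) f) <= c j * rnorm f.
  apply: cauchy_limit => [j l|e /(cf0 f)[L /(_ L (leqnn L))]]; first exact: prc.
  by exists L.
have [phi phiP] := choice phiex.
have philin : linear phi.
  apply: (@limit_linear R _ (fun l => vec_pair (b l))) => [l|f e /(cf0 f)[L hL]].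
    exact: vec_pair_linear.
  by exists L => l /hL; exact: le_trans.
have bN k : rnorm (rat_vec (b k) : H) <= 2.
  have -> : rat_vec (b k) = (rat_vec (b k) - rat_vec (b 0%N)) + rat_vec (b 0%N) :> H by rewrite subrK.
  apply: le_trans (ler_rnormD _ _) _.
  have := bcauchy 0%N k (leq0n k); rewrite b0E rnorm_basis.
  have : c 0%N <= 1 by rewrite /c invf_le1 ?exprn_gt0 // exprn_ege1 // ler1n.
  lra.
have c0E : c 0%N = 2^-1 by rewrite /c expr1.
apply: (@orthogonal_orbit_invariant T phi 3 x N) => //.
- move=> f; rewrite -[phi f](subrK (vec_pair (b 0%N) f)).
  apply: le_trans (ler_rnormD _ _) _.
  have := phiP f 0%N; have := pair_le (size (b 0%N)) (rat_vec (b 0%N)) f.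
  have := ler_wpM2r (rnorm_ge0 f) (bN 0%N); rewrite c0E /vec_pair.
  have := rnorm_ge0 f; lra.
- apply/eqP => x00; have := xa 0%N; rewrite x00 sub0r rnormN a0E.
  rewrite rnorm_basis c0E; lra.
- apply/eqP => p0; have := phiP (basis N) 0%N; rewrite p0 sub0r rnormN c0E rnorm_basis.
  have -> : vec_pair (b 0%N) (basis N : H) = 1.
    rewrite /vec_pair b0E /pair.
    have Nsz : (N < size (b 0%N))%N.
      rewrite ltnNge; apply/negP => /(rat_vec_support (R := R)).
      by rewrite b0E basisE eqxx => /eqP; rewrite oner_eq0.
    rewrite big_mkord (bigD1 (Ordinal Nsz)) // big1 ?addr0 => [|i iN].
      by rewrite !basisE /= eqxx mulr1 addr0.
    rewrite !basisE; case: eqP => [iN'|_]; last by rewrite mul0r.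
    by case/eqP: iN; exact/val_inj.
  rewrite /rnorm normr1 /=; lra.
move=> n n0; apply: rnorm_small0 => e e0.
have e4 : 0 < e / 4 by rewrite divr_gt0.
have [L1 h1] := cf0 x _ e4; have e8 : 0 < e / 8 by rewrite divr_gt0.
have [L2 h2] := c0 _ e8.
pose j := maxn L1 L2.
have {}h1 := h1 j (leq_maxl _ _); have {}h2 := h2 j (leq_maxr _ _).
have [[gn gM] _] := sgood j.
set th := tolerance (j + 3) (M j) (b j) in gn gM.
have thj : th ^+ 2 <= c j.
  have th0 : 0 < th := tolerance_gt0 _ _ _ .
  have th1 : th <= 2 ^- (j + 3).
    rewrite /th /tolerance ler_pdivrMr ?tolerance_den_gt0 // ler_peMr ?(ltW (half_pow_gt0 _)) //.
    have : 1 <= (M j).+1%:R :> R by rewrite ler1n.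
    have := sqr_ge0 (rnorm (rat_vec (b j) : H)).
    move: (_ ^+ 2) (_.+1%:R) => q m q0 m1; nra.
  have h3 : 2 ^- (j + 3) <= c j by apply: half_pow_le; lia.
  have h4 : c j <= 1 by rewrite /c invf_le1 ?exprn_gt0 // exprn_ege1 // ler1n.
  by nra.
have small : rnorm (vec_pair (b j) (iter n T (rat_vec (a j)))) <= c j.
  have [nM|Mn] := ltnP n (M j).
    by have := gn n; rewrite n0 nM => /(_ isT); have := c_ge0 j; lra.
  apply: le_trans (pair_le _ _ _) _.
  have : rnorm (iter n T (rat_vec (a j))) <= th ^+ 2 / 2.
    rewrite -(subnK Mn) iterD; apply: le_trans (P1_iter _ T1 _) _; exact: ltW.
  move=> h; have := ler_pM (rnorm_ge0 _) (rnorm_ge0 _) (bN j) h.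
  lra.
have -> : phi (iter n T x) = (phi (iter n T x) - vec_pair (b j) (iter n T x)) +
    vec_pair (b j) (iter n T (x - rat_vec (a j))) + vec_pair (b j) (iter n T (rat_vec (a j))).
  by rewrite iter_linearB {2}/vec_pair pairBr -/(vec_pair _ _) -/(vec_pair _ _) addrA subrK subrK.
apply: le_trans (ler_rnormD _ _) _.
apply: le_trans (lerD (ler_rnormD _ _) small) _.
have k1 : rnorm (phi (iter n T x) - vec_pair (b j) (iter n T x)) <= e / 4.
  apply: le_trans (phiP _ _) _; apply: le_trans h1.
  by rewrite ler_wpM2l //; exact: P1_iter.
have k2 : rnorm (vec_pair (b j) (iter n T (x - rat_vec (a j)))) <= 2 * c j.
  apply: le_trans (pair_le _ _ _) _; apply: ler_pM; rewrite ?rnorm_ge0 //.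
  by apply: le_trans (P1_iter _ T1 _) _; exact: xa.
lra.
Qed.

End Invariant.

(** * The two topologies *)

Section Topology.
Context {R : realType}.
Notation C := R[i].
Notation H := (ell2 R).
Notation bH := (bop H H).
Implicit Types (T S : bH).

Lemma SOT_coarser T (O : set bH) : nbhs (T : SOT H H) O -> nbhs (T : SOTstar H H) O.
Proof.
have /SOTstar_cvgE[/SOT_cvgE h _] : nbhs (T : SOTstar H H) --> (T : SOTstar H H).
  exact: cvg_id.
exact: h.
Qed.

Lemma iter_cvg (F : set_system bH) T : Filter F -> F P1 ->
  (forall x : H, (fun S : bH => S x) @ F --> T x) ->
  forall n (x : H), (fun S : bH => iter n S x) @ F --> iter n T x.
Proof.
move=> FF FP1 ST; elim=> [|n IH] x; first exact: cvg_cst.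
apply/cvg_rnormP => e e0; have e2 : 0 < e / 2 by rewrite divr_gt0.
have h1 : \forall S \near F, rnorm (iter n (S : bH) x - iter n T x) < e / 2.
  exact: (cvg_rnormP _ _ _).1 (IH x) _ e2.
have h2 : \forall S \near F, rnorm ((S : bH) (iter n T x) - T (iter n T x)) < e / 2.
  exact: (cvg_rnormP _ _ _).1 (ST (iter n T x)) _ e2.
near=> S; rewrite !iterS.
have -> : S (iter n S x) - T (iter n T x) =
    S (iter n S x - iter n T x) + (S (iter n T x) - T (iter n T x)).
  by rewrite (linearBf _ _ (bop_linear S)) addrA subrK.
have S1 : P1 S by near: S.
have k1 : rnorm (iter n S x - iter n T x) < e / 2 by near: S.
have k2 : rnorm (S (iter n T x) - T (iter n T x)) < e / 2 by near: S.
apply: le_lt_trans (ler_rnormD _ _) _.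
have := P1_contraction S1 (iter n S x - iter n T x); lra.
Unshelve. all: by end_near.
Qed.

Lemma near_gt_rnorm (F : set_system bH) (V : normedModType C) (u : bH -> V) v (d : R) :
  Filter F -> u @ F --> v -> d < rnorm v -> \forall S \near F, d < rnorm (u S).
Proof.
move=> FF uv dv; have e0 : 0 < rnorm v - d by rewrite subr_gt0.
apply: filterS ((cvg_rnormP _ _ _).1 uv _ e0) => S h.
have := ler_rnormD (v - u S) (u S); rewrite subrK rnormB_sym; lra.
Qed.

Lemma near_lt_rnorm (F : set_system bH) (V : normedModType C) (u : bH -> V) v (d : R) :
  Filter F -> u @ F --> v -> rnorm v < d -> \forall S \near F, rnorm (u S) < d.
Proof.
move=> FF uv dv; have e0 : 0 < d - rnorm v by rewrite subr_gt0.
apply: filterS ((cvg_rnormP _ _ _).1 uv _ e0) => S h.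
have := ler_rnormD (u S - v) v; rewrite subrK; lra.
Qed.

Section Near.
Context (F : set_system bH) (T : bH) {FF : Filter F} (FP1 : F P1).
Context (FT : forall x : H, (fun S : bH => S x) @ F --> T x).

Lemma vec_pair_cvg b n (x : H) :
  (fun S : bH => vec_pair b (iter n S x) : C^o) @ F --> (vec_pair b (iter n T x) : C^o).
Proof.
apply/cvg_rnormP => e e0.
have e0' : 0 < e / (1 + rnorm (rat_vec b : H)) by rewrite divr_gt0 // ltr_pwDl ?rnorm_ge0.
have h : \forall S \near F, rnorm (iter n (S : bH) x - iter n T x) <
    e / (1 + rnorm (rat_vec b : H)).
  by have := (cvg_rnormP _ _ FF).1 (@iter_cvg F T FF FP1 FT n x) _ e0'.
apply: filterS h => S.
rewrite ltr_pdivlMr ?ltr_pwDl ?rnorm_ge0 //; apply: le_lt_trans.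
rewrite /vec_pair -pairBr; apply: le_trans (pair_le _ _ _) _.
by rewrite mulrC ler_wpM2l ?rnorm_ge0 // lerDr.
Qed.

Lemma admissible_near k M a b : admissible k M a b T -> \forall S \near F, admissible k M a b S.
Proof.
move=> [gn gM]; apply: filterI; last first.
  exact: near_lt_rnorm (@iter_cvg F T FF FP1 FT M (rat_vec a)) gM.
have : forall m, (m <= M)%N -> \forall S \near F, forall n, (0 < n < m)%N ->
    rnorm (vec_pair b (iter n (S : bH) (rat_vec a))) < tolerance k M b ^+ 2 / 2.
  elim=> [|m IH] mM; first by apply: nearW => S n; rewrite ltn0 andbF.
  have [m0|m0] := posnP m.
    by apply: nearW => S [|n]; rewrite // m0 !ltnS ltn0 andbF.
  have mM' : (0 < m < M)%N by rewrite m0.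
  have h : \forall S \near F,
      rnorm (vec_pair b (iter m (S : bH) (rat_vec a))) < tolerance k M b ^+ 2 / 2.
    exact: near_lt_rnorm FF (@vec_pair_cvg b m (rat_vec a)) (gn m mM').
  apply: filterS2 (IH (ltnW mM)) h => S Sm Sh n /andP[n0].
  rewrite ltnS leq_eqVlt => /orP[/eqP -> //|nm].
  by apply: Sm; rewrite n0.
move=> /(_ M (leqnn M)); exact.
Qed.

Lemma improvable_near k M a b :
  improvable k M a b T -> \forall S \near F, improvable k M a b S.
Proof.
move=> [[[n nM h]|h]|[M' [a' [b' [h h1 h2]]]]].
- apply: filterS (near_gt_rnorm _ (@vec_pair_cvg b n (rat_vec a)) h) => S Sh.
  by left; left; exists n.
- apply: filterS (near_gt_rnorm _ (@iter_cvg F T FF FP1 FT M (rat_vec a)) h) => S Sh.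
  by left; right.
by apply: filterS (admissible_near h) => S Sh; right; exists M', a', b'.
Qed.

Lemma started_near : started T -> \forall S \near F, started S.
Proof.
move=> [M [a [b [N [h h1 h2]]]]].
by apply: filterS (admissible_near h) => S Sh; exists M, a, b, N.
Qed.

End Near.

(** One condition for each Gaussian rational datum of a step, and one for the
    starting point, enumerated by [pickle]. *)
Definition generic_condition (n : nat) : set bH :=
  match unpickle n : option (option (nat * nat * seq (rat * rat) * seq (rat * rat))) with
  | Some (Some (k, M, a, b)) => improvable k M a b
  | _ => started
  end.

Lemma generic_condition_SOT_open n T : P1 T -> generic_condition n T ->
  nbhs (T : SOT H H) [set S | P1 S -> generic_condition n S].
Proof.
move=> T1 cT; pose F := within P1 (nbhs (T : SOT H H)).
have FP1 : F P1 by exact: withinT.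
have FT : forall x : H, (fun S : bH => S x) @ F --> T x.
  by apply/SOT_cvgE; exact: cvg_within.
have FF : Filter F by exact: within_filter.
change (F (generic_condition n)); move: cT; rewrite /generic_condition.
case: unpickle => [[[[[k M] a] b]|]|].
- exact: (improvable_near FP1 FT).
- exact: (started_near FP1 FT).
- exact: (started_near FP1 FT).
Qed.

Lemma generic_condition_dense n T k : P1 T ->
  exists S, [/\ P1 S, close k (2 ^- k) S T & generic_condition n S].
Proof.
move=> T1; rewrite /generic_condition; case: unpickle => [[[[[l M] a] b]|]|].
- exact: improvable_dense.
- exact: started_dense.
- exact: started_dense.
Qed.

Lemma generic_condition_invariant T : P1 T -> (forall n, generic_condition n T) ->
  has_nontrivial_invariant_subspace T.
Proof.
move=> T1 cT; apply: improvable_invariant => // [|k M a b].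
- by have := cT (pickle (@None (nat * nat * seq (rat * rat) * seq (rat * rat))));
    rewrite /generic_condition pickleK.
- by have := cT (pickle (Some (k, M, a, b))); rewrite /generic_condition pickleK.
Qed.

Lemma generic_condition_all_dense T (O : set bH) : P1 T -> nbhs (T : SOTstar H H) O ->
  exists S, [/\ P1 S, O S & forall n, generic_condition n S].
Proof.
move=> T1 /(SOTstar_nbhs_close T1)[k kO].
have [||S [S1 /(kO S S1) OS Sc]] := @baire_P1 R generic_condition _ _ T k T1.
- move=> n S S1 Sc.
  have [l lO] := SOTstar_nbhs_close S1 (SOT_coarser (generic_condition_SOT_open S1 Sc)).
  by exists l => S' S'1 /(lO S' S'1); apply.
- by move=> n T' l; exact: generic_condition_dense.
by exists S.
Qed.

Lemma near_set_val (X : topologicalType) (A : set X) (z : A) (O : set X) :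
  nbhs (set_val z) O -> \forall x \near z, O (set_val x).
Proof. exact: (@initial_continuous _ _ (@set_val X A) z O). Qed.

(** Openness comes from [SOT] and density from [SOT^*], so the same argument serves
    every topology in between; [i] and [j] identify its carrier with the space of
    operators. *)
Lemma typical_between (X : topologicalType) (i : X -> bH) (j : bH -> X)
    (A : set X) : cancel j i -> (forall x, A x <-> P1 (i x)) ->
  (forall x O, nbhs (i x : SOT H H) O -> nbhs x (i @^-1` O)) ->
  (forall x O, nbhs x O -> nbhs (i x : SOTstar H H) (j @^-1` O)) ->
  typical A (fun x => has_nontrivial_invariant_subspace (i x)).
Proof.
move=> jK AP SX XS; pose W n := [set x : A | generic_condition n (i (set_val x))].
have A1 (x : A) : P1 (i (set_val x)) by apply/AP; exact: set_valP.
exists (\bigcap_n W n); split.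
- exists W => // n; rewrite openE => z Wz.
  have near_z := near_set_val (SX _ _ (generic_condition_SOT_open (A1 z) Wz)).
  by apply: filterS near_z => x Sx; apply: Sx; exact: A1.
- move=> O [z Oz] oO.
  have : nbhs z O by exact: open_nbhs_nbhs (conj oO Oz).
  case=> _ [[B oB <-] /= Bz BO].
  have Bn : nbhs (set_val z) B by exact: open_nbhs_nbhs (conj oB Bz).
  have [S [S1 BS Sc]] := generic_condition_all_dense (A1 z) (XS _ _ Bn).
  have AS : A (j S) by apply/AP; rewrite jK.
  exists (SigSub (mem_set AS)); split; first exact: BO.
  by move=> n _; rewrite /W /= set_valE /= jK.
- move=> z Wz /=; apply: generic_condition_invariant => // n; exact: Wz.
Qed.

End Topology.

Theorem theorem4p2 (R : realType) :
  typical (P1 : set (SOT (ell2 R) (ell2 R)))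
    has_nontrivial_invariant_subspace /\
  typical (P1 : set (SOTstar (ell2 R) (ell2 R)))
    has_nontrivial_invariant_subspace.
Proof.
split.
- apply: (@typical_between R (SOT (ell2 R) (ell2 R)) id id) => // T O.
  exact: SOT_coarser.
- apply: (@typical_between R (SOTstar (ell2 R) (ell2 R)) id id) => // T O.
  exact: SOT_coarser.
Qed.
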